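(* Let $v\le w$ in $S_n$ be such that there are no unexpected zeros, or such that there are no actual zeros. Then the complexity of $\mathcal N_{v,w}$ is $|P_v|-|D^\circ(w)|$. In particular, $\mathcal N_{v,w}$ is toric if and only if $|P_v|=|D^\circ(w)|$.
   Context: A permutation $v\in S_n$ is identified with the permutation matrix having $1$s at $(v(j),j)$. $D^\circ(v)=\{(i,j): v(j)<i,\ v^{-1}(i)>j\}$ is the opposite Rothe diagram, $\le$ the Bruhat order, $\ell$ the Coxeter length, $t_{a,b}$ the transposition of $a$ and $b$. Let $B$ (resp. $B_-$) be the upper (resp. lower) triangular Borel subgroup of $G=GL_n(\mathbb C)$ and $T$ the diagonal torus. The Kazhdan-Lusztig variety is $\mathcal N_{v,w}=\overline{BwB/B}\cap B_-vB/B\subset G/B$, of dimension $\ell(w)-\ell(v)=|D^\circ(v)|-|D^\circ(w)|$. It is identified with the set of matrices $Z\in\Sigma_v$ with $\mathrm{rank}$ of (rows $a,\dots,n$; columns $1,\dots,b$) of $Z$ at most that of the same submatrix of $w$, for all $a,b$; here $\Sigma_v$ is the affine space of matrices with $1$s at $(v(j),j)$, zeros at all positions north or east of such a $1$, and free entries $z_{ij}$ at the positions $(i,j)\in D^\circ(v)$. An actual zero is an $(i,j)\in D^\circ(v)$ such that the coordinate $z_{ij}$ vanishes identically on $\mathcal N_{v,w}$. An unexpected zero is an $(i,j)\in D^\circ(v)$ with $t_{v(j),i}\,v\not\le w$. The usual torus action on $\mathcal N_{v,w}$ is the action of $T$ by left multiplication; its weight cone is $\sigma_{v,w}=\mathrm{Cone}(e_{v(j)}-e_i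 : (i,j)\in D^\circ(v),\ t_{v(j),i}\,v\le w)\subset\mathbb R^n$, which equals the cone generated by $e_{v(j)}-e_i$ over all $(i,j)\in D^\circ(v)$ that are not actual zeros. The complexity is $\dim\mathcal N_{v,w}-\dim\sigma_{v,w}$; toric means complexity $0$. For $(i,j),(k,l)\in D^\circ(v)$ with $i<k$ and $j<l$ put $d((i,j),(k,l))=(k-i)+(l-j)$. The set $P_v\subseteq D^\circ(v)\times D^\circ(v)$ is defined recursively by increasing distance $d$: (i) $((i,j),(i+1,j+1))\in P_v$ whenever $(i,j),(i+1,j+1)\in D^\circ(v)$; (ii) a pair $((i,j),(k,l))$ of elements of $D^\circ(v)$ with $i<k$, $j<l$ and $d((i,j),(k,l))=d$ is in $P_v$ if there is not already some $((i,j),(k',l'))\in P_v$ with $d((i,j),(k',l'))<d$ or some $((i',j'),(k,l))\in P_v$ with $d((i',j'),(k,l))<d$. *)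

(* Defs.v *)
From HB Require Import structures.
From mathcomp Require Import all_boot all_order all_algebra all_fingroup.
From mathcomp Require Import boolp classical_sets reals.
From mathcomp Require Import complex.
From mathcomp Require Import mpoly.

Set Implicit Arguments.
Unset Strict Implicit.
Unset Printing Implicit Defensive.

Import Order.TTheory GRing.Theory Num.Theory.

Local Open Scope ring_scope.

(* Rows, columns and values are 0-based: 'I_n stands for {1, ..., n}.  A box
   (i, j) is in row i (counted from the top) and column j. *)
Notation box n := ('I_n * 'I_n)%type.

Section Permutations.
Variable n : nat.
Implicit Types v w : 'S_n.

(* 1s at the positions (w j, j), whereas perm_mx w has them at (j, w j). *)
Definition permutation_matrix (R : nzRingType) w : 'M[R]_n := (perm_mx w)^T.

(* The Coxeter length of a permutation is its number of inversions. *)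
Definition coxeter_length v : nat :=
  #|[set p : box n | (p.1 < p.2)%N && (v p.2 < v p.1)%N]|.

Definition bruhat_step : rel 'S_n := fun v w =>
  [exists a, exists b, w == (v * tperm a b)%g]
    && (coxeter_length v < coxeter_length w)%N.

Definition bruhat : rel 'S_n := connect bruhat_step.

Definition opp_rothe v : {set box n} :=
  [set p : box n | (v p.2 < p.1)%N && (p.2 < (v^-1)%g p.1)%N].

(* t_{v(j), i} v for p = (i, j); products in 'S_n apply the left factor first,
   so this permutation is x |-> t_{v(j), i} (v x). *)
Definition reflect_at v (p : box n) : 'S_n := (v * tperm (v p.2) p.1)%g.

Definition unexpected_zero v w (p : box n) : bool :=
  (p \in opp_rothe v) && ~~ bruhat (reflect_at v p) w.

Definition northwest (p q : box n) : bool := (p.1 < q.1)%N && (p.2 < q.2)%N.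

Definition distance (p q : box n) : nat := ((q.1 - p.1) + (q.2 - p.2))%N.

(* The members of P_v at distance < d.  The smallest possible distance is 2,
   attained exactly by the pairs ((i, j), (i+1, j+1)); nothing precedes them,
   so all those in the diagram are included. *)
Fixpoint pairs_below v (d : nat) : {set box n * box n} :=
  if d is d'.+1 then
    pairs_below v d' :|:
    [set pq : box n * box n |
      [&& pq.1 \in opp_rothe v, pq.2 \in opp_rothe v,
          northwest pq.1 pq.2, distance pq.1 pq.2 == d',
          ~~ [exists q, (pq.1, q) \in pairs_below v d']
        & ~~ [exists p, (p, pq.2) \in pairs_below v d']]]
  else finset.set0.

(* All distances are < 2n. *)
Definition rothe_pairs v : {set box n * box n} := pairs_below v (2 * n).

End Permutations.

Section Geometry.
Variables (R : realType) (n : nat).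
Implicit Types v w : 'S_n.

(* Rank of the submatrix on the rows >= a and the columns <= b. *)
Definition southwest_rank (Z : 'M[R[i]]_n) (a b : 'I_n) : nat :=
  \rank (mxsub (fun k : 'I_#|[pred i : 'I_n | (a <= i)%N]| => enum_val k)
               (fun l : 'I_#|[pred j : 'I_n | (j <= b)%N]| => enum_val l) Z).

Definition Sigma_slice v : set 'M[R[i]]_n :=
  [set Z | (forall j, Z (v j) j = 1) /\
           (forall i j : 'I_n,
              (i < v j)%N || ((v^-1)%g i < j)%N -> Z i j = 0)].

Definition KL_variety v w : set 'M[R[i]]_n :=
  [set Z | Sigma_slice v Z /\
           forall a b, (southwest_rank Z a b <=
                        southwest_rank (permutation_matrix _ w) a b)%N].

Definition actual_zero v w (p : box n) : Prop :=
  p \in opp_rothe v /\ forall Z, KL_variety v w Z -> Z p.1 p.2 = 0.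

(* The regular functions on X are the restrictions of the polynomials in the
   n * n matrix entries; the members of f are algebraically independent as
   regular functions on X. *)
Definition alg_independent_on (X : set 'M[R[i]]_n) (d : nat)
    (f : 'I_d -> {mpoly R[i][n * n]}) : Prop :=
  forall Q : {mpoly R[i][d]},
    (forall Z, X Z ->
       Q.@[fun k => (f k).@[fun e => mxvec Z 0 e]] = 0) -> Q = 0.

(* The dimension of an affine algebraic set, as the transcendence degree of
   its coordinate ring over R[i]; it is at most the dimension n * n of the
   ambient affine space. *)
Definition variety_dim (X : set 'M[R[i]]_n) : nat :=
  \max_(d < (n * n).+1 |
        `[< exists f : 'I_d -> {mpoly R[i][n * n]}, alg_independent_on X f >])
    (d : nat).

Definition cone_generated (I : finType) (S : {set I}) (g : I -> 'rV[R]_n) :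
    set 'rV[R]_n :=
  [set x | exists2 c : I -> R, (forall k, 0 <= c k) &
           x = \sum_(k in S) c k *: g k].

(* The dimension of the linear span of a cone: the largest number of linearly
   independent vectors in the cone. *)
Definition cone_dim (C : set 'rV[R]_n) : nat :=
  \max_(d < n.+1 |
        `[< exists A : 'M[R]_(d, n), row_free A /\ forall k, C (row k A) >])
    (d : nat).

Definition coord_vector (i : 'I_n) : 'rV[R]_n := delta_mx 0 i.

Definition weight_cone v w : set 'rV[R]_n :=
  cone_generated
    [set p : box n | (p \in opp_rothe v) && bruhat (reflect_at v p) w]
    (fun p => coord_vector (v p.2) - coord_vector p.1).

Definition complexity v w : int :=
  (variety_dim (KL_variety v w))%:Z - (cone_dim (weight_cone v w))%:Z.

Definition toric v w : Prop := complexity v w = 0.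

End Geometry.

Arguments actual_zero R {n} v w p.
Arguments complexity R {n} v w.
Arguments toric R {n} v w.

(* Main.v *)
(* The complexity is dim N_{v,w} - dim sigma_{v,w}, and the two dimensions are
   computed separately.

   Dimension of the variety: N_{v,w} is the union of the strata Sigma_v /\ BuB
   with v <= u <= w.  Going up one cover u < u' in Bruhat order, the stratum of
   u lies in the closure of that of u', the latter is irreducible (move along
   the lines joining the triangular factors, then retract onto Sigma_v by
   elimination), and a minor vanishes on the first but not on the second: so a
   system of independent functions gains one member.  Climbing from v to w gives
   the lower bound; climbing from u to the top, where the number of independent
   functions on the affine space Sigma_v is at most |D(v)|, the upper bound.

   Dimension of the cone: for a box q let p be the nearest box to its northwest
   such that the box in the row of p and the column of q is in D(v) or is a dot.
   Then q is the nearest such box to the southeast of p, and P_v consists of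
   exactly these pairs (p, q).  The vector of q is a combination of those of
   boxes preceding q, and the vectors of the boxes that are not second in any
   pair form a triangular system.

   When no coordinate vanishes identically, a point with z_p <> 0 degenerates
   under a one-parameter torus to v + z_p E_p, which lies in the double coset of
   t_p v, unless the weight of p is a sum of shorter weights of coordinates that
   do not vanish at the point. *)

Require Import Defs.
From mathcomp Require Import all_boot all_order all_algebra all_fingroup reals.
From mathcomp Require Import boolp classical_sets complex mpoly zify ring.
Set Implicit Arguments.
Unset Strict Implicit.
Unset Printing Implicit Defensive.
Import Order.TTheory GRing.Theory Num.Theory.
Local Open Scope ring_scope.

(** * Covers and dot counts in Bruhat order *)

Section PermutationCombinatorics.
Local Open Scope nat_scope.
Variable n : nat.
Implicit Types (u v w : 'S_n) (p q : box n).

Lemma mem_opp_rothe v p :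
  (p \in opp_rothe v) = (v p.2 < p.1) && (p.2 < (v^-1)%g p.1).
Proof. by rewrite inE. Qed.

Lemma perm_neq v (x y : 'I_n) : x != y -> (v x : nat) != v y.
Proof. by move=> xy; rewrite (inj_eq val_inj) (inj_eq perm_inj). Qed.

Lemma reflect_atE v p x : reflect_at v p x =
  if x == p.2 then p.1 else if x == (v^-1)%g p.1 then v p.2 else v x.
Proof.
rewrite /reflect_at permM; case: eqP => [->|/eqP xp]; first by rewrite tpermL.
case: eqP => [->|/eqP xq]; first by rewrite permKV tpermR.
rewrite tpermD //; first by rewrite (inj_eq perm_inj) eq_sym.
by apply: contraNneq xq => ->; rewrite permK.
Qed.

Lemma sum_pairs_split (F : 'I_n -> 'I_n -> nat) (j k : 'I_n) : j != k ->
  \sum_x \sum_y F x y =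
    \sum_(x | (x != j) && (x != k)) \sum_(y | (y != j) && (y != k)) F x y
    + \sum_(z | (z != j) && (z != k)) (F z j + F z k + F j z + F k z)
    + (F j j + F j k + F k j + F k k).
Proof.
move=> jk; have kj : k != j by rewrite eq_sym.
have split1 (G : 'I_n -> nat) :
    \sum_y G y = G j + G k + \sum_(y | (y != j) && (y != k)) G y.
  by rewrite (bigD1 j) //= (bigD1 k) //= addnA.
rewrite split1; under [X in _ + X]eq_bigr => x _ do rewrite split1.
rewrite !split1 !big_split /=; lia.
Qed.

Lemma card_pairs_sum (P : 'I_n -> 'I_n -> bool) :
  #|[set q : box n | P q.1 q.2]| = \sum_x \sum_y (P x y : nat).
Proof.
rewrite pair_bigA /= -sum1dep_card big_mkcond /=.
by apply: eq_bigr => q _; case: P.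
Qed.

Definition noninversions v : nat :=
  \sum_(x < n) \sum_(y < n) ((x < y) && (v x < v y) : nat).

Lemma coxeter_lengthE v :
  coxeter_length v = \sum_(x < n) \sum_(y < n) ((x < y) && (v y < v x) : nat).
Proof. by rewrite -(card_pairs_sum (fun x y : 'I_n => (x < y) && (v y < v x))). Qed.

(** A noninversion x < y, v x < v y corresponds to the box (v y, x). *)
Lemma card_opp_rothe v : #|opp_rothe v| = noninversions v.
Proof.
rewrite /noninversions -(card_pairs_sum (fun x y : 'I_n => (x < y) && (v x < v y))).
rewrite -(card_imset (f := fun q : box n => (v q.2, q.1))); last first.
  by move=> [a b] [c d] /= [/perm_inj -> ->].
apply: eq_card => -[i j]; rewrite mem_opp_rothe /=; apply/idP/imsetP.
  move=> /andP[h1 h2]; exists (j, (v^-1)%g i); last by rewrite /= permKV.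
  by rewrite inE /= permKV h1 h2.
case=> -[a b]; rewrite inE /= => /andP[ab vab] [-> ->].
by rewrite permK ab vab.
Qed.

Lemma length_noninversions v w :
  coxeter_length v + noninversions v = coxeter_length w + noninversions w.
Proof.
rewrite !coxeter_lengthE /noninversions -!big_split /=.
apply: eq_bigr => x _; rewrite -!big_split /=; apply: eq_bigr => y _.
case: (eqVneq x y) => [->|xy]; first by rewrite ltnn.
have := perm_neq v xy; have := perm_neq w xy; lia.
Qed.

(** The condition for the swap at [p] to be a cover in Bruhat order. *)
Definition no_dot_between v p :=
  forall x : 'I_n, p.2 < x -> x < (v^-1)%g p.1 -> ~~ ((v p.2 < v x) && (v x < p.1)).

(** Only pairs that meet a swapped position change. A third position z never loses inversions with
    the swapped two, and gains some only if its dot lies inside the rectangle; the swapped pair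
    itself contributes one. *)
Lemma length_reflect v p : p \in opp_rothe v ->
  coxeter_length v < coxeter_length (reflect_at v p) /\
  (no_dot_between v p -> coxeter_length (reflect_at v p) = (coxeter_length v).+1).
Proof.
rewrite mem_opp_rothe => /andP[]; case: p => i j /=.
have [k kE] : exists k, k = (v^-1)%g i by eexists.
have vk : v k = i by rewrite kE permKV.
rewrite -kE -vk => vjk jk.
have jk' : j != k by rewrite -(inj_eq val_inj) neq_ltn jk.
have uE x : reflect_at v (i, j) x = if x == j then v k else if x == k then v j else v x.
  by rewrite reflect_atE /= vk kE.
rewrite vk !coxeter_lengthE !(sum_pairs_split _ jk') !uE !eqxx (eq_sym k).
rewrite (negbTE jk').
set A := \sum_(x | _) _; set A' := \sum_(x | _) \sum_(y | _) _.
have -> : A = A'.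
  apply: eq_bigr => x /andP[xj xk]; apply: eq_bigr => y /andP[yj yk].
  by rewrite !uE (negbTE xj) (negbTE xk) (negbTE yj) (negbTE yk).
set B := \sum_(z | _) _; set B' := \sum_(z | _) _.
have BB' : B <= B'.
  apply: leq_sum => z /andP[zj zk]; rewrite !uE (negbTE zj) (negbTE zk).
  have := perm_neq v zj; have := perm_neq v zk; move: zj zk.
  rewrite -!(inj_eq val_inj) /=; lia.
split=> [|nomid]; first lia.
suff -> : B = B' by lia.
apply: eq_bigr => z /andP[zj zk]; rewrite !uE (negbTE zj) (negbTE zk).
have := perm_neq v zj; have := perm_neq v zk; move: zj zk.
have := nomid z; rewrite -!(inj_eq val_inj) /= -kE -vk; lia.
Qed.

Lemma bruhat_length v w : bruhat v w -> coxeter_length v <= coxeter_length w.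
Proof.
move=> /connectP[s]; elim: s v => [|u s IH] v /= => [_ -> //|/andP[vu su] ws].
by apply: leq_trans (IH _ su ws); move: vu => /andP[_] /ltnW.
Qed.

(** The rank of a southwest corner of the permutation matrix. The bounds are naturals, because the
    row bound [(w p).+1] used below may equal n. *)
Definition dot_count v (a b : nat) : nat := \sum_(j < n) ((j <= b) && (a <= v j) : nat).

Definition dots_le v w := forall a b, dot_count v a b <= dot_count w a b.

Lemma dots_le_refl v : dots_le v v. Proof. by move=> a b. Qed.

Lemma dots_le_trans u v w : dots_le u v -> dots_le v w -> dots_le u w.
Proof. by move=> h1 h2 a b; apply: leq_trans (h1 a b) (h2 a b). Qed.

Lemma dot_count_reflect v p a b : p \in opp_rothe v ->
  dot_count (reflect_at v p) a b = dot_count v a b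
    + ((p.2 <= b < (v^-1)%g p.1) && (v p.2 < a <= p.1) : nat).
Proof.
rewrite mem_opp_rothe => /andP[]; case: p => i j /=.
have [k kE] : exists k, k = (v^-1)%g i by eexists.
have vk : v k = i by rewrite kE permKV.
rewrite -kE -vk => vjk jk.
have jk' : k != j by rewrite -(inj_eq val_inj) neq_ltn jk orbT.
have uE x : reflect_at v (i, j) x = if x == j then v k else if x == k then v j else v x.
  by rewrite reflect_atE /= vk kE.
rewrite vk /dot_count !(bigD1 j isT) /= !(bigD1 k jk') /= !uE !eqxx (negbTE jk').
set A := \sum_(x | _) _; set A' := \sum_(x | _) _.
suff -> : A = A' by rewrite -vk; lia.
by apply: eq_bigr => z /andP[zj zk]; rewrite !uE (negbTE zj) (negbTE zk).
Qed.

Lemma dots_le_reflect v p : p \in opp_rothe v -> dots_le v (reflect_at v p).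
Proof. by move=> pv a b; rewrite dot_count_reflect // leq_addr. Qed.

Lemma dots_lt_reflect v p : p \in opp_rothe v ->
  exists a b : 'I_n, dot_count v a b < dot_count (reflect_at v p) a b.
Proof.
move=> pv; exists p.1, p.2; rewrite dot_count_reflect //.
by move: pv; rewrite mem_opp_rothe => /andP[-> ->]; rewrite !leqnn addn1.
Qed.

Lemma reflect_at_step v p : p \in opp_rothe v -> bruhat_step v (reflect_at v p).
Proof.
move=> pv; apply/andP; split; last by have [] := length_reflect pv.
by apply/existsP; exists (v p.2); apply/existsP; exists p.1.
Qed.

(** Name the values so that a stands before b in v. If a < b, the swap is at a box of v; if a > b,
    then v is a reflection of w at a box of w, and the length would drop. *)
Lemma bruhat_step_reflect v w : bruhat_step v w ->
  exists2 p, p \in opp_rothe v & w = reflect_at v p.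
Proof.
case/andP=> /existsP[a /existsP[b /eqP wE]] lvw.
wlog ab : a b wE / (v^-1)%g a < (v^-1)%g b => [wl|].
  case: (ltngtP ((v^-1)%g a) ((v^-1)%g b)) => [| |/val_inj/perm_inj ab].
  - exact: wl.
  - by apply: wl; rewrite tpermC.
  - by move: lvw; rewrite wE ab tperm1 mulg1 ltnn.
case: (ltngtP a b) => [lab|lab|/val_inj eab].
- exists (b, (v^-1)%g a); last by rewrite /reflect_at /= permKV.
  by rewrite mem_opp_rothe /= permKV lab ab.
- have Vw : v = (w * tperm a b)%g by rewrite wE -mulgA tperm2 mulg1.
  have wa : w ((v^-1)%g a) = b by rewrite wE permM permKV tpermL.
  have wb : w ((v^-1)%g b) = a by rewrite wE permM permKV tpermR.
  have wVa : (w^-1)%g a = (v^-1)%g b by rewrite -wb permK.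
  have pw : (a, (v^-1)%g a) \in opp_rothe w.
    by rewrite mem_opp_rothe /= wa lab wVa ab.
  have [] := length_reflect pw.
  by rewrite /reflect_at /= wa tpermC -Vw ltnNge (ltnW lvw).
- by move: ab; rewrite eab ltnn.
Qed.

Lemma bruhat_dots v w : bruhat v w -> dots_le v w.
Proof.
move=> /connectP[s]; elim: s v => [|u s IH] v /=.
  by move=> _ ->; apply: dots_le_refl.
move=> /andP[/bruhat_step_reflect[p pv ->] us] ws.
exact: dots_le_trans (dots_le_reflect pv) (IH _ us ws).
Qed.

(* The cover is found by swapping the first entry where v and w differ with
   the next entry of v lying above it and not exceeding the value in w. *)
Lemma dots_le_cover v w : dots_le v w -> v != w ->
  exists p, [/\ p \in opp_rothe v, no_dot_between v p & dots_le (reflect_at v p) w].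
Proof.
move=> vw /eqP nvw.
have /existsP[x0 x0P] : [exists x, v x != w x].
  case: existsP => // h; case: nvw; apply/permP => x.
  by apply/eqP/negPn/negP => vwx; apply: h; exists x.
case: (arg_minnP (P := fun x => v x != w x) (fun x : 'I_n => x : nat) x0P) => p pP pmin.
have before (x : 'I_n) : x < p -> v x = w x.
  by move=> xp; apply/eqP; apply: contraTT xp => /pmin; rewrite -leqNgt.
have neq_nat : (v p : nat) != w p by rewrite (inj_eq val_inj).
(* Otherwise the corner at (v p, p) holds one more dot of v than of w, the earlier columns being
   equal. *)
have vwp : v p < w p.
  rewrite ltn_neqAle neq_nat /= leqNgt; apply/negP => wvp.
  have := vw (v p) p; rewrite /dot_count !(bigD1 (P := xpredT) p) //= !leqnn /=.
  rewrite [v p <= w p]leqNgt wvp /= (eq_bigr (fun j : 'I_n => (j <= p) && (v p <= w j) : nat)).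
    by lia.
  move=> x xp; have [xp'|xp'] := ltnP x p; first by rewrite (before _ xp').
  by rewrite leqNgt ltn_neqAle xp' andbT eq_sym (inj_eq val_inj) xp.
have [k kE] : exists k, v k = w p by exists ((v^-1)%g (w p)); rewrite permKV.
have pk : p < k.
  rewrite ltnNge leq_eqVlt negb_or; apply/andP; split.
    by apply: contraNneq pP => /val_inj kp; rewrite -kE kp.
  by apply/negP => kp; move: kE (kp); rewrite (before _ kp) => /perm_inj ->; rewrite ltnn.
have kP : [&& p < k, v p < v k & v k <= w p] by rewrite pk kE leqnn vwp.
case: (arg_minnP (P := fun x : 'I_n => [&& p < x, v p < v x & v x <= w p])
        (fun x : 'I_n => x : nat) kP) => q /and3P[pq vpq vqw] qmin.
exists (v q, p); split.
- by rewrite mem_opp_rothe /= permK pq vpq.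
- move=> x /=; rewrite permK => px xq; apply/negP => /andP[vpx vxq].
  by have := qmin x; rewrite px vpx (leq_trans (ltnW vxq) vqw) leqNgt xq; move/(_ isT).
have pv : (v q, p) \in opp_rothe v by rewrite mem_opp_rothe /= permK pq vpq.
move=> a b; rewrite (dot_count_reflect _ _ pv) /= permK.
case: andP => [[/andP[pb bq] /andP[pa aq]]|_]; last by rewrite addn0.
(* Cut the corner at row w p. The lower part is compared by hypothesis, the strip column by column:
   column p of w absorbs the extra dot, and by minimality of q the columns of v strictly between p
   and q have no dot in the strip. *)
have cut u : dot_count u a b = dot_count u (w p).+1 b
    + \sum_(j < n) ((j <= b) && (a <= u j <= w p) : nat).
  rewrite /dot_count -big_split /=; apply: eq_bigr => j _; lia.
rewrite !cut -addnA addn1; apply: leq_add => //.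
rewrite (bigD1 p) // [leqRHS](bigD1 p) //= pb (leq_trans aq vqw) leqnn /=.
have -> : (a <= v p) = false by lia.
rewrite /= add0n add1n ltnS; apply: leq_sum => j jp.
have [jp'|jp'] := ltnP j p; first by rewrite (before _ jp').
have {}jp' : p < j by rewrite ltn_neqAle eq_sym (inj_eq val_inj) jp.
have := qmin j; lia.
Qed.

(** Climbs a saturated chain from v to w; the number of noninversions drops at each cover. *)
Lemma dots_le_ind w (P : 'S_n -> Prop) :
  (forall v p, p \in opp_rothe v -> no_dot_between v p ->
     dots_le (reflect_at v p) w -> P (reflect_at v p) -> P v) ->
  P w -> forall v, dots_le v w -> P v.
Proof.
move=> step Pw v; have [m] := ubnP (noninversions v).
elim: m v => // m IH v; rewrite ltnS => vm vw; case: (eqVneq v w) => [-> //|nvw].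
have [p [pv pmid le]] := dots_le_cover vw nvw.
apply: (step _ p) => //; apply: IH => //; apply: leq_trans vm.
have [lt _] := length_reflect pv.
by have := length_noninversions v (reflect_at v p); lia.
Qed.

Lemma dots_le_bruhat v w : dots_le v w -> bruhat v w.
Proof.
move: v; apply: dots_le_ind; last exact: connect0.
move=> v p pv _ _; apply: connect_trans; apply: connect1; exact: reflect_at_step.
Qed.

Lemma noninversions_reflect v p : p \in opp_rothe v -> no_dot_between v p ->
  #|opp_rothe v| = #|opp_rothe (reflect_at v p)|.+1.
Proof.
move=> pv /(proj2 (length_reflect pv)); rewrite !card_opp_rothe.
by have := length_noninversions v (reflect_at v p); lia.
Qed.

Lemma dots_le_card v w : dots_le v w -> #|opp_rothe w| <= #|opp_rothe v|.
Proof.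
move/dots_le_bruhat/bruhat_length; rewrite !card_opp_rothe.
by have := length_noninversions v w; lia.
Qed.

(** Take the box horizontally nearest to the dot of its row: a dot inside the rectangle would give a
    nearer one. *)
Lemma cover_exists v : 0 < #|opp_rothe v| ->
  exists2 p, p \in opp_rothe v & no_dot_between v p.
Proof.
case/card_gt0P => p0 p0v.
case: (arg_minnP (fun q : box n => (v^-1)%g q.1 - q.2) p0v) => p pv pmin.
exists p => // x px xq; apply/negP => /andP[vpx vxp].
have /pmin /= : (v x, p.2) \in opp_rothe v by rewrite mem_opp_rothe /= permK px vpx.
by rewrite permK; lia.
Qed.

End PermutationCombinatorics.

(** * The matching P_v and the span of the diagram *)

Section RothePairs.
Local Open Scope nat_scope.
Variable n : nat.
Implicit Types (v : 'S_n) (p q : box n).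

(* For p northwest of q in the diagram: the box in the row of p and the column
   of q is again in the diagram, or is a dot. *)
Definition linked v p q : bool :=
  [&& p \in opp_rothe v, q \in opp_rothe v, northwest p q,
      v q.2 <= p.1 & q.2 <= (v^-1)%g p.1].

Definition matched v p q : bool :=
  linked v p q && [forall p', linked v p' q ==> (p'.1 <= p.1) && (p'.2 <= p.2)].

Lemma matchedP v p q : reflect
  (linked v p q /\ forall p', linked v p' q -> p'.1 <= p.1 /\ p'.2 <= p.2)
  (matched v p q).
Proof.
apply: (iffP andP) => -[pq h]; split=> //.
  by move=> p' p'q; apply/andP; apply: implyP (forallP h p') p'q.
by apply/forallP => p'; apply/implyP => /h[-> ->].
Qed.

Lemma matched_linked v p q : matched v p q -> linked v p q.
Proof. by case/andP. Qed.

Lemma linkedP v p q : reflect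
  [/\ v p.2 < p.1, q.2 < (v^-1)%g q.1, p.1 < q.1, p.2 < q.2 &
      v q.2 <= p.1 /\ q.2 <= (v^-1)%g p.1]
  (linked v p q).
Proof.
rewrite /linked /northwest !mem_opp_rothe.
apply: (iffP idP) => [|[h1 h2 h3 h4 [h5 h6]]]; last by lia.
by move=> h; split; first [lia | split; lia].
Qed.

Lemma perm_leq_neq v (x y : 'I_n) : x <= (v^-1)%g y -> v x != y -> x < (v^-1)%g y.
Proof.
rewrite leq_eqVlt => /orP[/eqP/val_inj->|//]; by rewrite permKV eqxx.
Qed.

(** The coordinates are maximised in turn: the greatest row i < k whose dot is not left of column l,
    then the greatest column j < l whose dot is above row i. A greater row admits more columns, so
    the result dominates every linked box. *)
Lemma matched_left v p' q : linked v p' q ->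
  exists2 p, matched v p q & p'.1 <= p.1 /\ p'.2 <= p.2.
Proof.
case/linkedP; case: p' => i0 j0; case: q => k l /= vj0 lk i0k j0l [vl li0].
have vlP : (v l < k) && (l <= (v^-1)%g (v l)) by rewrite permK leqnn andbT; lia.
case: (arg_maxnP (P := fun i : 'I_n => (i < k) && (l <= (v^-1)%g i))
         (fun i : 'I_n => i : nat) vlP) => i /andP[ik li] imax.
have i0i : i0 <= i by apply: imax; rewrite i0k li0.
have j0P : (j0 < l) && (v j0 < i) by rewrite j0l (leq_trans vj0).
case: (arg_maxnP (P := fun j : 'I_n => (j < l) && (v j < i))
         (fun j : 'I_n => j : nat) j0P) => j /andP[jl vj] jmax.
have vli := imax _ vlP.
exists (i, j); last by split=> //=; apply: jmax.
apply/matchedP; split; first by apply/linkedP.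
move=> [i' j'] /linkedP[/= vj' _ i'k j'l [_ li']].
have i'i : i' <= i by apply: imax; rewrite i'k li'.
by split=> //; apply: jmax; rewrite j'l (leq_trans vj').
Qed.

(** Otherwise a box beyond p would be linked to q: (i, l') if l' < l, and (k', j) if k' < k. *)
Lemma matched_min v p q q' : matched v p q -> linked v p q' ->
  q.1 <= q'.1 /\ q.2 <= q'.2.
Proof.
move=> /matchedP[/linkedP[]]; case: p q q' => i j [k l] [k' l'] /=.
move=> vj lk ik jl [vl li] pmax /linkedP[/= _ l'k' ik' jl' [vl' l'i]].
have ll' : l <= l'.
  rewrite leqNgt; apply/negP => l'l.
  have vl'i : v l' < i.
    rewrite ltn_neqAle vl' andbT (inj_eq val_inj).
    by apply: contraTneq li => <-; rewrite permK -ltnNge.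
  have /pmax /= : linked v (i, l') (k, l) by apply/linkedP.
  lia.
split=> //; rewrite leqNgt; apply/negP => k'k.
have /pmax /= : linked v (k', j) (k, l) by apply/linkedP; split => //=; lia.
lia.
Qed.

Lemma min_matched v p q : linked v p q ->
  (forall q', linked v p q' -> q.1 <= q'.1 /\ q.2 <= q'.2) -> matched v p q.
Proof.
move=> pq qmin; apply/matchedP; split=> // -[i' j'] /linkedP[/= vj' _].
case: p q pq qmin => i j [k l] /linkedP[/= vj lk ik jl [vl li]] qmin i'k j'l [vl' li'].
have i'i : i' <= i.
  rewrite leqNgt; apply/negP => ii'.
  have li'' : l < (v^-1)%g i'.
    apply: perm_leq_neq => //; apply: contraTneq ii' => <-; by rewrite -leqNgt.
  have /qmin /= : linked v (i, j) (i', l) by apply/linkedP.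
  lia.
split=> //; rewrite leqNgt; apply/negP => jj'.
have /qmin /= : linked v (i, j) (k, j') by apply/linkedP; split=> //=; lia.
lia.
Qed.

(** Mirror image of [matched_left]: the least column l > j whose dot is not below row i, then the
    least row k > i whose dot is right of column l. *)
Lemma matched_right v p q' : linked v p q' ->
  exists2 q, matched v p q & q.1 <= q'.1 /\ q.2 <= q'.2.
Proof.
case/linkedP; case: p => i j; case: q' => k0 l0 /= vj l0k0 ik0 jl0 [vl0 l0i].
have iP : (j < (v^-1)%g i) && (v ((v^-1)%g i) <= i) by rewrite permKV leqnn andbT; lia.
case: (arg_minnP (P := fun l : 'I_n => (j < l) && (v l <= i))
         (fun i : 'I_n => i : nat) iP) => l /andP[jl vl] lmin.
have ll0 : l <= l0 by apply: lmin; rewrite jl0 vl0.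
have k0P : (i < k0) && (l < (v^-1)%g k0) by rewrite ik0 (leq_ltn_trans ll0).
case: (arg_minnP (P := fun k : 'I_n => (i < k) && (l < (v^-1)%g k))
         (fun i : 'I_n => i : nat) k0P) => k /andP[ik lk] kmin.
have li := lmin _ iP.
exists (k, l); last by split=> //=; apply: kmin.
apply: min_matched; first by apply/linkedP.
move=> [k' l'] /linkedP[/= _ l'k' ik' jl' [vl' _]].
have ll' : l <= l' by apply: lmin; rewrite jl' vl'.
by split=> //; apply: kmin; rewrite ik' (leq_ltn_trans ll').
Qed.

Lemma box_eq p q : p.1 = q.1 :> nat -> p.2 = q.2 :> nat -> p = q.
Proof. by case: p q => i j [k l] /= /val_inj -> /val_inj ->. Qed.

Lemma matched_inj_left v p p' q : matched v p q -> matched v p' q -> p = p'.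
Proof.
move=> /matchedP[pq pmax] /matchedP[p'q p'max].
by have := pmax _ p'q; have := p'max _ pq => -[? ?] [? ?]; apply: box_eq; lia.
Qed.

Lemma matched_inj_right v p q q' : matched v p q -> matched v p q' -> q = q'.
Proof.
move=> pq pq'.
have := matched_min pq (matched_linked pq').
have := matched_min pq' (matched_linked pq).
by move=> [? ?] [? ?]; apply: box_eq; lia.
Qed.

(** If p and q are linked, the match of q is nearer than p. If not, either the dot of row i is left
    of column l, and p is linked to the box of row k in the column of that dot, or the dot of column
    l is below row i, and the box of column j in the row of that dot is linked to q. In both cases
    the match so obtained is nearer. *)
Lemma unmatched_blocked v p q :
  p \in opp_rothe v -> q \in opp_rothe v -> northwest p q -> ~~ matched v p q ->
  (exists2 q', matched v p q' & distance p q' < distance p q) \/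
  (exists2 p', matched v p' q & distance p' q < distance p q).
Proof.
move=> pv qv pq npq; have [lpq|] := boolP (linked v p q).
  have [p' p'q [le1 le2]] := matched_left lpq; right; exists p' => //.
  have /andP[i'k j'l] : northwest p' q.
    by move/matched_linked/and5P: p'q => -[].
  rewrite /distance; case: (ltngtP p.1 p'.1) le1 => // e1 _; first lia.
  case: (ltngtP p.2 p'.2) le2 => // e2 _; first lia.
  by move: npq; rewrite (box_eq e1 e2) p'q.
move: pv qv pq {npq}; rewrite !mem_opp_rothe /northwest.
case: p q => i j [k l] /= /andP[vj ji] /andP[vl lk] /andP[ik jl] nl.
have [il|li] := ltnP ((v^-1)%g i) l.
  have lk' : linked v (i, j) (k, (v^-1)%g i).
    apply/linkedP; split=> //=; [exact: ltn_trans il lk|].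
    by rewrite permKV.
  have [q' pq' [/= le1 le2]] := matched_right lk'; left; exists q' => //.
  by rewrite /distance /=; lia.
have ivl : i < v l.
  by rewrite ltnNge; apply: contra nl => vli; apply/linkedP.
have lk' : linked v (v l, j) (k, l).
  by apply/linkedP; split=> //=; [apply: ltn_trans vj ivl | rewrite permK].
have [p' p'q [/= le1 le2]] := matched_left lk'; right; exists p' => //.
have /andP[/= i'k j'l] : northwest p' (k, l).
  by move/matched_linked/and5P: p'q => -[].
by rewrite /distance /=; lia.
Qed.

(** An unmatched pair is excluded by a nearer match of one of its members ([unmatched_blocked]); a
    matched pair is never excluded, as matches are unique on both sides. *)
Lemma pairs_belowE v d : pairs_below v d =
  [set pq | matched v pq.1 pq.2 && (distance pq.1 pq.2 < d)].
Proof.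
elim: d => [|d IH]; first by apply/setP => pq; rewrite !inE ltn0 andbF.
apply/setP => -[p q]; rewrite /= inE IH !inE /= ltnS [in RHS]leq_eqVlt andb_orr [RHS]orbC.
congr (_ || _); apply/idP/idP => [/and5P[pv qv pq /eqP dpq /andP[np nq]]|].
  rewrite -!mem_opp_rothe in pv qv.
  rewrite dpq eqxx andbT; apply: contraT => /(unmatched_blocked pv qv pq).
  case=> -[r rm]; rewrite dpq => rd.
    by case/existsP: np; exists r; rewrite inE /= rm.
  by case/existsP: nq; exists r; rewrite inE /= rm.
case/andP=> pq /eqP dpq; have /and5P[pv qv -> _ _] := matched_linked pq.
move: pv qv; rewrite !mem_opp_rothe => -> ->.
rewrite dpq eqxx /=; apply/andP; split; apply/existsP => -[r]; rewrite inE /=.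
  by case/andP=> /(matched_inj_right pq) <-; rewrite dpq ltnn.
by case/andP=> /(matched_inj_left pq) <-; rewrite dpq ltnn.
Qed.

(** By [matched_left] these are the boxes second in no pair of P_v; their vectors will form a basis
    of the span of the weights. *)
Definition cut_boxes v : {set box n} :=
  [set q in opp_rothe v | ~~ [exists p, linked v p q]].

Lemma card_cut_boxes v : #|cut_boxes v| + #|rothe_pairs v| = #|opp_rothe v|.
Proof.
have -> : #|rothe_pairs v| = #|[set q in opp_rothe v | [exists p, linked v p q]]|.
  rewrite /rothe_pairs pairs_belowE -(card_in_imset (f := snd)) => [|[p q] [p' q']]; last first.
    rewrite !inE /= => /andP[pq _] /andP[pq' _] eqq; move: pq'; rewrite -eqq.
    by move=> /(matched_inj_left pq) ->.
  apply: eq_card => q; apply/imsetP/idP => [[[p q'] ]|].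
    rewrite !inE /= => /andP[/matched_linked pq _] ->.
    have /and5P[_ qv _ _ _] := pq; move: qv; rewrite inE => -> /=.
    by apply/existsP; exists p.
  rewrite inE => /andP[_ /existsP[p' /matched_left[p pq _]]].
  exists (p, q) => //; rewrite !inE /= pq /distance /=.
  by case: (q) => k l /=; have := ltn_ord k; have := ltn_ord l; lia.
rewrite -cardsUI; set I := _ :&: _; have -> : I = finset.set0.
  by apply/setP => q; rewrite !inE; case: [exists _, _]; rewrite ?andbF.
rewrite cards0 addn0; apply: eq_card => q; rewrite !inE.
by case: [exists _, _]; rewrite ?andbT ?andbF ?orbF.
Qed.

End RothePairs.

(** * A basis of the span of the weights *)

Section BoxVectors.
Variables (R : realType) (n : nat) (v : 'S_n).
Implicit Types (p q : box n).

Definition box_vector p : 'rV[R]_n := coord_vector R (v p.2) - coord_vector R p.1.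

Definition cut_matrix : 'M[R]_(#|cut_boxes v|, n) :=
  \matrix_k box_vector (enum_val k).

(** Induction in row-major order. If (i, j) is linked to q = (k, l), the vector of q is that of (k,
    j) minus that of (i, j) plus that of (i, l). All three positions come earlier, and (i, l) is a
    box or a dot, whose vector is zero. *)
Lemma box_vector_span q : q \in opp_rothe v -> (box_vector q <= cut_matrix)%MS.
Proof.
have [m] := ubnP (q.1 * n + q.2)%N.
elim: m q => // m IH q; rewrite ltnS => qm qv.
have [/existsP[p pq]|ncut] := boolP [exists p, linked v p q]; last first.
  have qc : q \in cut_boxes v by rewrite inE qv.
  rewrite -(_ : row (enum_rank_in qc q) cut_matrix = box_vector q) ?row_sub //.
  by rewrite rowK enum_rankK_in.
have /and5P[pv _ _ _ _] := pq.
case: p q pq qv qm pv => i j [k l] /linkedP[/= vj lk ik jl [vl li]] qv qm pv.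
have IHrow (j' : 'I_n) : (i, j') \in opp_rothe v -> (box_vector (i, j') <= cut_matrix)%MS.
  by apply: IH; apply: leq_trans qm => /=; have := ltn_ord j'; nia.
have -> : box_vector (k, l) =
    box_vector (k, j) - box_vector (i, j) + box_vector (i, l).
  rewrite /box_vector /= !opprB.
  by apply/rowP => c; rewrite !mxE; ring.
apply: addmx_sub; last first.
  case: (eqVneq (v l) i) => [<-|vli]; first by rewrite /box_vector /= subrr sub0mx.
  apply: IHrow; rewrite mem_opp_rothe /= (perm_leq_neq li vli) andbT.
  by rewrite ltn_neqAle vl (inj_eq val_inj) vli.
apply: addmx_sub; last by rewrite eqmx_opp; apply: IHrow.
apply: IH; first by apply: leq_trans qm => /=; lia.
by rewrite mem_opp_rothe /=; lia.
Qed.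

(* The functional separating a cut box q from the cut boxes preceding it. *)
Definition dots_right (q : box n) (x : 'rV[R]_n) : R :=
  \sum_(m < n | (m < q.1)%N && (q.2 <= (v^-1)%g m)%N) x 0 m.

Lemma dots_right_sum q (I : finType) (x : I -> 'rV[R]_n) (c : I -> R) :
  dots_right q (\sum_k c k *: x k) = \sum_k c k * dots_right q (x k).
Proof.
rewrite /dots_right; under [RHS]eq_bigr do rewrite mulr_sumr.
rewrite exchange_big /=; apply: eq_bigr => m _; rewrite summxE.
by apply: eq_bigr => k _; rewrite mxE.
Qed.

Lemma dots_right_box q p : dots_right q (box_vector p) =
  ((v p.2 < q.1)%N && (q.2 <= p.2)%N)%:R - ((p.1 < q.1)%N && (q.2 <= (v^-1)%g p.1)%N)%:R.
Proof.
have coordE (k : 'I_n) : dots_right q (coord_vector R k) =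
    ((k < q.1)%N && (q.2 <= (v^-1)%g k)%N)%:R.
  rewrite /dots_right big_mkcond (bigD1 k) //= big1 ?addr0 => [|m mk].
    by rewrite mxE !eqxx; case: ifP.
  by rewrite mxE (negbTE mk) andbF; case: ifP.
rewrite -{2}(permK v p.2) -!coordE /dots_right -sumrB.
by apply: eq_bigr => m _; rewrite !mxE.
Qed.

(** In a linear relation take the last box (i, j), in row-major order, with a nonzero coefficient.
    Its functional [dots_right] is 1 there and 0 on earlier cut boxes: a nonzero value at (i', j')
    would link (i', j') or (v j, j') to (i, j). *)
Lemma cut_matrix_free : row_free cut_matrix.
Proof.
rewrite -kermx_eq0; apply/rowV0P => u /sub_kermxP; rewrite mulmx_sum_row => u0.
apply/rowP => k0; rewrite mxE; apply/eqP; case: (boolP (_ == 0)) => // k0P.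
pose pos (k : 'I_#|cut_boxes v|) := ((enum_val k).1 * n + (enum_val k).2)%N.
case: (arg_maxnP (P := fun k => u 0 k != 0) pos k0P) => k kP kmax {k0 k0P}.
have := dots_right_sum (enum_val k) (fun k => row k cut_matrix) (u 0).
rewrite u0 {1}/dots_right big1 => [|m _]; last by rewrite mxE.
have := enum_valP k; rewrite (bigD1 k) //= rowK dots_right_box.
move: {kmax}(kmax); rewrite /pos; case: (enum_val k) (@enum_val_inj _ _ k) => i j kinj kmax.
rewrite inE mem_opp_rothe /= => /andP[/andP[vj ji] /existsPn ncut].
rewrite vj leqnn ltnn subr0 mulr1 big1 ?addr0 => [u0k|k' k'k]; first by rewrite -u0k eqxx in kP.
have [->|uk'] := eqVneq (u 0 k') 0; first by rewrite mul0r.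
have := kmax _ uk'; have := enum_valP k'; rewrite rowK dots_right_box.
case: (enum_val k') (kinj k') => i' j' neq.
rewrite inE mem_opp_rothe /= => /andP[/andP[vj' j'i'] _] le.
have i'i : (i' <= i)%N by have := ltn_ord j; nia.
have [e|i'ne] := eqVneq i' i.
  move: le; rewrite e leq_add2l leq_eqVlt => /orP[/eqP/val_inj ej|j'j].
    by case/eqP: k'k; apply/esym/neq; rewrite e ej.
  by rewrite ltnn (_ : (j <= j')%N = false) ?andbF ?subr0 ?mulr0 //; lia.
have {}i'i : (i' < i)%N by rewrite ltn_neqAle i'i (inj_eq val_inj) i'ne.
rewrite i'i (ltn_trans vj' i'i) /=.
have [jj'|j'j] := leqP j j'; first by rewrite (leq_trans jj' (ltnW j'i')) subrr mulr0.
have [ji'|//] := leqP j ((v^-1)%g i'); last by rewrite subrr mulr0.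
have [vji'|i'vj] := leqP (v j) i'.
  by case/negP: (ncut (i', j')); apply/linkedP.
case/negP: (ncut (v j, j')); apply/linkedP; split=> //=; last by rewrite permK.
exact: ltn_trans vj' i'vj.
Qed.

End BoxVectors.

(** * Dimension of the weight cone *)

Section Cones.
Variables (R : realType) (n : nat).

Section Generated.
Variables (I : finType) (S : {set I}) (g : I -> 'rV[R]_n).

Lemma cone_generated_gen k : k \in S -> cone_generated S g (g k).
Proof.
move=> kS; exists (fun j => (j == k)%:R) => [j|]; first exact: ler0n.
rewrite (bigD1 k) //= eqxx scale1r big1 ?addr0 // => j /andP[_ /negbTE->].
by rewrite scale0r.
Qed.

Lemma cone_generated0 : cone_generated S g 0.
Proof. by exists (fun=> 0) => //; rewrite big1 // => k _; rewrite scale0r. Qed.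

Lemma cone_generatedD x y :
  cone_generated S g x -> cone_generated S g y -> cone_generated S g (x + y).
Proof.
move=> [c c0 ->] [d d0 ->]; exists (fun k => c k + d k) => [k|].
  exact: addr_ge0.
by rewrite -big_split; apply: eq_bigr => k _; rewrite scalerDl.
Qed.

End Generated.

Lemma bigmax_bool_eq (m : nat) (P : nat -> bool) (d : nat) : (d < m.+1)%N -> P d ->
  (forall e, (e < m.+1)%N -> P e -> (e <= d)%N) -> (\max_(e < m.+1 | P e) (e : nat))%N = d.
Proof.
move=> dm Pd dmax; apply/eqP; rewrite eqn_leq; apply/andP; split.
  by apply/bigmax_leqP => e; apply: dmax.
exact: (leq_bigmax_cond (Ordinal dm)).
Qed.

Lemma weight_cone_dim (v w : 'S_n) :
  (forall q, q \in opp_rothe v -> weight_cone v w (box_vector R v q)) ->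
  cone_dim (weight_cone (R := R) v w) = #|cut_boxes v|.
Proof.
move=> inC; rewrite /cone_dim.
pose P d := `[< exists A : 'M[R]_(d, n), row_free A /\ forall k, weight_cone v w (row k A) >].
have := cut_matrix_free R v; move=> free.
apply: (@bigmax_bool_eq n P).
- by rewrite ltnS -(eqP free) rank_leq_col.
- apply/asboolP; exists (cut_matrix R v); split=> // k.
  by rewrite rowK; apply: inC; have := enum_valP k; rewrite inE => /andP[].
- move=> e _ /asboolP[A [/eqP Afree AC]]; rewrite -Afree -(eqP free).
  apply: mxrankS; apply/row_subP => k; have [c _ ->] := AC k.
  apply: summx_sub => q; rewrite inE => /andP[qv _]; apply: scalemx_sub.
  exact: box_vector_span.
Qed.

End Cones.

(** * Triangular orbits and corner ranks *)

Section SubmatrixRanks.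
Variable F : fieldType.

Lemma rowsub1_free m n (f : 'I_m -> 'I_n) : injective f ->
  row_free (rowsub f (1%:M : 'M[F]_n)).
Proof.
move=> finj; apply/row_freeP; exists (rowsub f 1%:M)^T.
apply/matrixP => k l; rewrite !mxE (bigD1 (f k)) //= big1 => [|i ik]; last first.
  by rewrite !mxE eq_sym (negbTE ik) mul0r.
by rewrite !mxE eqxx mul1r addr0 (inj_eq finj) eq_sym.
Qed.

(** The rows chosen by f only involve each other under A, as the bottom rows do for an upper
    triangular A. *)
Lemma mxsub_mul_closed m p n (f : 'I_m -> 'I_n) (g : 'I_p -> 'I_n) (A Z : 'M[F]_n) :
  injective f -> (forall k i, A (f k) i != 0 -> i \in codom f) ->
  mxsub f g (A *m Z) = mxsub f f A *m mxsub f g Z.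
Proof.
move=> finj fA; apply/matrixP => k l; rewrite !mxE.
rewrite (bigID (mem (codom f))) /= addrC big1 ?add0r => [|i ni]; last first.
  have [->|/fA] := eqVneq (A (f k) i) 0; first by rewrite mul0r.
  by rewrite (negbTE ni).
(* The default k is never reached, since i lies in the image of f. *)
rewrite (reindex_onto f (fun i => odflt k [pick x | f x == i])) /=; last first.
  move=> i /codomP[x ->]; case: pickP => [y /eqP //|/(_ x)]; by rewrite eqxx.
rewrite [LHS](eq_bigl xpredT) => [|x]; first by apply: eq_bigr => x _; rewrite !mxE.
rewrite codom_f /=; case: pickP => [y /eqP/finj ->|/(_ x)]; by rewrite eqxx.
Qed.

(** The m chosen rows of A are independent, and they factor through the square block, which
    therefore has rank m. *)
Lemma mxsub_closed_free m n (f : 'I_m -> 'I_n) (A : 'M[F]_n) :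
  injective f -> (forall k i, A (f k) i != 0 -> i \in codom f) -> A \in unitmx ->
  row_free (mxsub f f A) && row_full (mxsub f f A).
Proof.
move=> finj fA Au.
suff free : row_free (mxsub f f A) by rewrite free -[row_full _]/(\rank _ == m) (eqP free) /=.
rewrite /row_free eqn_leq rank_leq_row /=.
have : \rank (rowsub f A) = m.
  rewrite -[A in rowsub f A]mul1mx -mul_rowsub_mx mxrankMfree ?row_free_unit //.
  exact/eqP/rowsub1_free.
have -> : rowsub f A = mxsub f id (A *m 1%:M) by rewrite mulmx1.
by rewrite (mxsub_mul_closed _ _ finj fA) => {1}<-; apply: mxrankM_maxl.
Qed.

Lemma rank_mxsub_mull m p n (f : 'I_m -> 'I_n) (g : 'I_p -> 'I_n) (A Z : 'M[F]_n) :
  injective f -> (forall k i, A (f k) i != 0 -> i \in codom f) -> A \in unitmx ->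
  \rank (mxsub f g (A *m Z)) = \rank (mxsub f g Z).
Proof.
move=> finj fA Au; rewrite mxsub_mul_closed //.
by have /andP[_ full] := mxsub_closed_free finj fA Au; rewrite (eqmxMfull _ full).
Qed.

Lemma rank_mxsub_mulr m p n (f : 'I_m -> 'I_n) (g : 'I_p -> 'I_n) (A Z : 'M[F]_n) :
  injective g -> (forall k i, A i (g k) != 0 -> i \in codom g) -> A \in unitmx ->
  \rank (mxsub f g (Z *m A)) = \rank (mxsub f g Z).
Proof.
move=> ginj gA Au; rewrite -[LHS]mxrank_tr -[RHS]mxrank_tr !trmx_mxsub trmx_mul.
by apply: rank_mxsub_mull; rewrite ?unitmx_tr // => k i; rewrite mxE; apply: gA.
Qed.

(** Let N consist of the nonzero columns. The submatrix factors through N, which bounds its rank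
    above, and [N^T *m N = 1] bounds it below. *)
Lemma rank_mxsub_perm m p n (f : 'I_m -> 'I_n) (g : 'I_p -> 'I_n) (w : 'S_n) :
  injective f -> injective g ->
  \rank (mxsub f g (permutation_matrix F w)) = #|[set l | w (g l) \in codom f]|.
Proof.
move=> finj ginj; set T := [set l | _]; set M := mxsub _ _ _.
have ME k l : M k l = (f k == w (g l))%:R by rewrite !mxE eq_sym.
pose N := colsub (enum_val : 'I_#|T| -> _) M.
have NtN : N^T *m N = 1%:M.
  apply/matrixP => s t; have := enum_valP s; rewrite inE => /codomP[k wk].
  rewrite mxE (bigD1 k) //= big1 => [|k' k'k]; last first.
    by rewrite mxE [N _ s]mxE ME wk (inj_eq finj) (negbTE k'k) mul0r.
  rewrite addr0 mxE [N k s]mxE [N k t]mxE !ME wk eqxx mul1r -wk (inj_eq perm_inj).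
  by rewrite (inj_eq ginj) (inj_eq enum_val_inj) mxE.
have MN : M = N *m rowsub enum_val 1%:M.
  apply/matrixP => k l; rewrite [RHS]mxE; have [lT|lT] := boolP (l \in T).
    rewrite (bigD1 (enum_rank_in lT l)) //= big1 => [|t].
      by rewrite !mxE enum_rankK_in // eqxx mulr1 addr0.
    rewrite -(inj_eq enum_val_inj) enum_rankK_in // => /negbTE tl.
    by rewrite !mxE tl mulr0.
  rewrite big1 => [|t _].
    rewrite ME (_ : _ == _ = false) //; apply/negP => /eqP e; case/negP: lT.
    by rewrite inE -e codom_f.
  rewrite !mxE (_ : enum_val t == l = false) ?mulr0 //.
  by apply/negP => /eqP e; case/negP: lT; rewrite -e enum_valP.
apply/eqP; rewrite eqn_leq; apply/andP; split.
  by rewrite MN (leq_trans (mxrankM_maxl _ _)) // rank_leq_col.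
apply: (@leq_trans (\rank N)).
  by rewrite -{1}(mxrank1 F #|T|) -NtN mxrankM_maxr.
by rewrite /N -[M in mxsub _ _ M]mulmx1 -mulmx_colsub mxrankM_maxl.
Qed.

End SubmatrixRanks.

Section Borel.
Variables (F : fieldType) (n : nat).
Implicit Types (A B Z : 'M[F]_n).

Definition borel A := (forall i j : 'I_n, (j < i)%N -> A i j = 0) /\ A \in unitmx.

Lemma borel1 : borel 1%:M.
Proof. by split=> [i j ji|]; rewrite ?unitmx1 // mxE -val_eqE /= gtn_eqF. Qed.

Lemma borelM A B : borel A -> borel B -> borel (A *m B).
Proof.
move=> [A0 Au] [B0 Bu]; split=> [i j ji|]; last by rewrite unitmx_mul Au.
rewrite mxE big1 // => k _; have [ki|ik] := ltnP k i; first by rewrite A0 ?mul0r.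
by rewrite B0 ?mulr0 //; apply: leq_trans ik.
Qed.

Lemma upper_borel A : (forall i j : 'I_n, (j < i)%N -> A i j = 0) ->
  (forall i, A i i != 0) -> borel A.
Proof.
move=> A0 Ad; split=> //; rewrite unitmxE -det_tr det_trig ?unitfE.
  by apply/prodf_neq0 => i _; rewrite mxE.
by apply/is_trig_mxP => i j ij; rewrite mxE A0.
Qed.

Lemma borel_diag A i : borel A -> A i i != 0.
Proof.
move=> [A0]; rewrite unitmxE -det_tr det_trig ?unitfE.
  by move/prodf_neq0/(_ i isT); rewrite mxE.
by apply/is_trig_mxP => k l kl; rewrite mxE A0.
Qed.

(** In column j of the inverse take the lowest nonzero entry, in row i. If i > j, the entry (i, j)
    of the product is a diagonal entry of A times it, hence not zero. *)
Lemma borelV A : borel A -> borel (invmx A).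
Proof.
move=> bA; have [A0 Au] := bA; split; last by rewrite unitmx_inv.
move=> i0 j ji0; apply/eqP/negPn/negP => Bij.
case: (arg_maxnP (P := fun i => invmx A i j != 0) (fun i : 'I_n => i : nat) Bij) => i Bi imax.
have ji : (j < i)%N by apply: leq_trans ji0 (imax _ Bij).
have := congr1 (fun M : 'M_n => M i j) (mulmxV Au).
rewrite !mxE (bigD1 i) //= big1 => [|k ki].
  rewrite addr0 -val_eqE /= gtn_eqF // => /eqP.
  by rewrite mulf_eq0 (negbTE Bi) (negbTE (borel_diag i bA)).
have [ki'|ik] := ltnP k i; first by rewrite A0 ?mul0r.
have [->|/imax] := eqVneq (invmx A k j) 0; first by rewrite mulr0.
by move=> ki'; case/eqP: ki; apply/val_inj/eqP; rewrite eqn_leq ik andbT.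
Qed.

Definition borel_orbit Z Z' := exists A B, [/\ borel A, borel B & Z' = A *m Z *m B].

Lemma borel_orbit_refl Z : borel_orbit Z Z.
Proof.
by exists 1%:M, 1%:M; rewrite mul1mx mulmx1; split=> //; apply: borel1.
Qed.

Lemma borel_orbit_trans Z1 Z2 Z3 :
  borel_orbit Z1 Z2 -> borel_orbit Z2 Z3 -> borel_orbit Z1 Z3.
Proof.
move=> [A [B [bA bB ->]]] [A' [B' [bA' bB' ->]]].
exists (A' *m A), (B *m B'); rewrite !mulmxA; split=> //; exact: borelM.
Qed.

Lemma borel_orbit_sym Z1 Z2 : borel_orbit Z1 Z2 -> borel_orbit Z2 Z1.
Proof.
move=> [A [B [bA bB ->]]]; exists (invmx A), (invmx B); split; try exact: borelV.
have [_ Au] := bA; have [_ Bu] := bB.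
by rewrite -!mulmxA mulmxV // mulmx1 mulKmx.
Qed.

End Borel.

Section CornerRank.
Variables (F : fieldType) (n : nat).
Implicit Types (Z : 'M[F]_n) (u w : 'S_n).

(** This is [southwest_rank] over an arbitrary field. *)
Definition corner_rank Z (a b : 'I_n) : nat :=
  \rank (mxsub (fun k : 'I_#|[pred i : 'I_n | (a <= i)%N]| => enum_val k)
               (fun l : 'I_#|[pred j : 'I_n | (j <= b)%N]| => enum_val l) Z).

(** Upper triangular factors add lower rows to higher ones and earlier columns to later ones, so the
    corner is only multiplied by invertible blocks. *)
Lemma corner_rank_orbit Z Z' a b :
  borel_orbit Z Z' -> corner_rank Z' a b = corner_rank Z a b.
Proof.
move=> [A [B [[A0 Au] [B0 Bu] ->]]]; rewrite /corner_rank -mulmxA.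
have enum_inj (P : pred 'I_n) : injective (fun k : 'I_#|P| => enum_val k).
  exact: enum_val_inj.
have mem_enum (P : pred 'I_n) i : P i -> i \in codom (fun k : 'I_#|P| => enum_val k).
  by move=> Pi; apply/codomP; exists (enum_rank_in Pi i); rewrite enum_rankK_in.
rewrite (rank_mxsub_mull _ _ (@enum_inj _) _ Au); last first.
  move=> k i Aki; apply: mem_enum; have := enum_valP k; rewrite !inE => ak.
  rewrite /= (leq_trans ak) // leqNgt; apply/negP => ik.
  by rewrite A0 ?eqxx in Aki.
rewrite (rank_mxsub_mulr _ _ (@enum_inj _) _ Bu) // => k i Bik; apply: mem_enum.
have := enum_valP k; rewrite !inE => kb.
rewrite /= (leq_trans _ kb) // leqNgt; apply/negP => ki.
by rewrite B0 ?eqxx in Bik.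
Qed.

Lemma corner_rank_perm w (a b : 'I_n) :
  corner_rank (permutation_matrix F w) a b = dot_count w a b.
Proof.
rewrite /corner_rank rank_mxsub_perm; try exact: enum_val_inj.
rewrite -(card_imset _ enum_val_inj) /dot_count -big_mkcond /= sum1dep_card.
apply: eq_card => j; rewrite !inE; apply/imsetP/idP.
  move=> [l]; rewrite inE => /codomP[k wk] ->.
  have lb : (enum_val l <= b)%N := enum_valP l.
  by have ak : (a <= enum_val k)%N := enum_valP k; rewrite lb wk ak.
case/andP=> jb awj; have jP : j \in [pred j : 'I_n | (j <= b)%N] by [].
have wP : w j \in [pred i : 'I_n | (a <= i)%N] by [].
exists (enum_rank_in jP j); last by rewrite enum_rankK_in.
rewrite inE enum_rankK_in //; apply/codomP; exists (enum_rank_in wP (w j)).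
by rewrite enum_rankK_in.
Qed.

Lemma corner_rank_dots_le u w :
  (forall a b, (corner_rank (permutation_matrix F u) a b <=
                corner_rank (permutation_matrix F w) a b)%N) <-> dots_le u w.
Proof.
split=> [h a b|h a b]; last by rewrite !corner_rank_perm.
(* Corners with a >= n are empty, and those with b >= n equal the one with b = n-1. *)
have [na|an] := leqP n a.
  rewrite /dot_count big1 // => j _; rewrite (_ : (a <= _)%N = false) ?andbF //.
  by apply/negbTE; rewrite -ltnNge (leq_trans (ltn_ord _)).
have [nb|bn] := leqP n b; last first.
  by have := h (Ordinal an) (Ordinal bn); rewrite !corner_rank_perm.
have n0 : (n.-1 < n)%N by lia.
have := h (Ordinal an) (Ordinal n0); rewrite !corner_rank_perm /=.
have bE w' : dot_count w' a b = dot_count w' a n.-1.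
  by apply: eq_bigr => j _; have := ltn_ord j; lia.
by rewrite !bE.
Qed.

End CornerRank.

(** * Gaussian elimination inside a double coset *)

Section Elimination.
Variables (F : fieldType) (n : nat).
Implicit Types (G Z : 'M[F]_n) (r c : 'I_n) (u : 'S_n).

(** With a zero pivot the inverse is 0 and the operation is the identity, so it preserves the orbit
    without any condition. *)
Definition clear_east r c G : 'M[F]_n :=
  \matrix_(i, j) (G i j - (c < j)%N%:R * (G i c * (G r j / G r c))).

Definition clear_north r c G : 'M[F]_n :=
  \matrix_(i, j) (G i j - (i < r)%N%:R * (G i c / G r c * G r j)).

Lemma clear_east_orbit r c G : borel_orbit G (clear_east r c G).
Proof.
pose E : 'M[F]_n :=
  \matrix_(i, j) ((i == j)%:R - (i == c)%:R * ((c < j)%N%:R * (G r j / G r c))).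
exists 1%:M, E; split; first exact: borel1.
  apply: upper_borel => [i j ji|i]; rewrite mxE.
    rewrite -val_eqE /= gtn_eqF // sub0r; case: eqP => [ic|]; last by rewrite mul0r oppr0.
    by rewrite -ic ltnNge (ltnW ji) mul0r mulr0 oppr0.
  rewrite eqxx; case: (i =P c) => [->|_]; last by rewrite mul0r subr0 oner_eq0.
  by rewrite ltnn mul0r mulr0 subr0 oner_eq0.
apply/matrixP => i j; rewrite mul1mx !mxE.
under eq_bigr => k _ do rewrite mxE mulrBr.
rewrite sumrB (bigD1 j) //= eqxx mulr1 big1 ?addr0 => [|k /negbTE ->]; last by rewrite mulr0.
congr (_ - _); rewrite (bigD1 c) //= eqxx big1 ?addr0 => [|k /negbTE ->].
  by rewrite mul1r mulrCA.
by rewrite mul0r mulr0.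
Qed.

Lemma clear_north_orbit r c G : borel_orbit G (clear_north r c G).
Proof.
pose E : 'M[F]_n :=
  \matrix_(i, j) ((i == j)%:R - (j == r)%:R * ((i < r)%N%:R * (G i c / G r c))).
exists E, 1%:M; split; last 2 [exact: borel1].
  apply: upper_borel => [i j ji|i]; rewrite mxE.
    rewrite -val_eqE /= gtn_eqF // sub0r; case: eqP => [jr|]; last by rewrite mul0r oppr0.
    by rewrite -jr ltnNge (ltnW ji) mul0r mulr0 oppr0.
  rewrite eqxx; case: (i =P r) => [->|_]; last by rewrite mul0r subr0 oner_eq0.
  by rewrite ltnn mul0r mulr0 subr0 oner_eq0.
apply/matrixP => i j; rewrite mulmx1 !mxE.
under eq_bigr => k _ do rewrite mxE mulrBl.
rewrite sumrB (bigD1 i) //= eqxx mul1r big1 ?addr0 => [|k ki]; last first.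
  by rewrite eq_sym (negbTE ki) mul0r.
congr (_ - _); rewrite (bigD1 r) //= eqxx big1 ?addr0 => [|k /negbTE ->].
  by rewrite mul1r mulrA.
by rewrite !mul0r.
Qed.

Lemma scale_columns_orbit G (d : 'I_n -> F) : (forall j, d j != 0) ->
  borel_orbit G (\matrix_(i, j) (G i j * d j)).
Proof.
move=> d0; exists 1%:M, (diag_mx (\row_j d j)); split; first exact: borel1.
  apply: upper_borel => [i j ji|i]; rewrite !mxE ?eqxx ?mulr1n //.
  by rewrite -val_eqE /= gtn_eqF.
by rewrite mul1mx mul_mx_diag; apply/matrixP => i j; rewrite !mxE.
Qed.

Lemma borel_orbit_unit Z G : borel_orbit Z G -> Z \in unitmx -> G \in unitmx.
Proof. by move=> [A [B [[_ Au] [_ Bu] ->]]] Zu; rewrite !unitmx_mul Au Zu. Qed.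

Lemma permutation_matrixE u i j : permutation_matrix F u i j = (i == u j)%:R.
Proof. by rewrite !mxE eq_sym. Qed.

(** Columns are treated from left to right. The pivot is the lowest nonzero entry of the column;
    clearing above it and to its right leaves a unit column and a row that vanishes further on. The
    pivots form the permutation. *)
Lemma bruhat_decomposition Z : Z \in unitmx ->
  exists u, borel_orbit (permutation_matrix F u) Z.
Proof.
move=> Zu.
have elimination k : (k <= n)%N ->
    exists G f, borel_orbit Z G /\ forall c : 'I_n, (c < k)%N ->
      (forall i, G i c = (i == f c)%:R) /\ (forall j : 'I_n, (c < j)%N -> G (f c) j = 0).
  elim: k => [_|k IH kn].
    by exists Z, id; split=> //; apply: borel_orbit_refl.
  have [G [f [ZG Gf]]] := IH (ltnW kn); pose c := Ordinal kn.
  have Gu := borel_orbit_unit ZG Zu.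
  have /existsP[i0 i0P] : [exists i, G i c != 0].
    case: existsP => // h; have : invmx G *m G = 1%:M by rewrite mulVmx.
    move/matrixP/(_ c c)/eqP; rewrite !mxE eqxx big1 ?(eq_sym 0) ?oner_eq0 // => i _.
    suff -> : G i c = 0 by rewrite mulr0.
    by apply/eqP/negPn/negP => Gi; apply: h; exists i.
  case: (arg_maxnP (P := fun i => G i c != 0) (fun i : 'I_n => i : nat) i0P) => i iP imax.
  have ifc (c' : 'I_n) : (c' < k)%N -> i != f c'.
    by move=> /[dup]/Gf[_ G0] c'k; apply: contraNneq iP => ->; rewrite G0.
  set G1 := clear_north i c G; set G2 := clear_east i c G1.
  pose d (j : 'I_n) := if j == c then (G i c)^-1 else 1.
  exists (\matrix_(i, j) (G2 i j * d j)), (fun x => if x == c then i else f x); split.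
    apply: borel_orbit_trans ZG _; apply: borel_orbit_trans (clear_north_orbit i c G) _.
    apply: borel_orbit_trans (clear_east_orbit i c _) _.
    apply: scale_columns_orbit => j; rewrite /d; case: ifP => _; last exact: oner_neq0.
    by rewrite invr_eq0.
  have G1c m : G1 m c = (m == i)%:R * G i c.
    rewrite mxE; case: (ltngtP m i) => [mi|im|/val_inj->].
    - by rewrite -val_eqE /= ltn_eqF // mul0r mul1r divfK // subrr.
    - rewrite -val_eqE /= gtn_eqF // !mul0r subr0; apply/eqP; apply: contraTT im.
      by move=> /imax; rewrite -leqNgt.
    - by rewrite eqxx mul0r subr0 mul1r.
  have G2row m j : m != i -> G2 m j = G1 m j.
    by move=> mi; rewrite mxE G1c (negbTE mi) !mul0r mulr0 subr0.
  have G2col m (j : 'I_n) : (j <= c)%N -> G2 m j = G1 m j.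
    by move=> jc; rewrite mxE ltnNge jc mul0r subr0.
  move=> c'; rewrite ltnS leq_eqVlt => /orP[/eqP c'k|c'k].
    have -> : c' = c by apply: val_inj.
    rewrite eqxx; split=> [m|j cj].
      by rewrite mxE G2col // G1c /d eqxx mulfK.
    rewrite mxE [G2 i j]mxE cj G1c eqxx !mul1r mulrCA divff // mulr1 subrr.
    by rewrite mul0r.
  have c'c : c' != c by rewrite -val_eqE /= ltn_eqF.
  have [G1' G0'] := Gf _ c'k; rewrite (negbTE c'c); split=> [m|j c'j].
    rewrite mxE /d (negbTE c'c) mulr1 G2col; last exact: ltnW.
    by rewrite mxE (G1' i) (negbTE (ifc _ c'k)) !mulr0 subr0.
  rewrite mxE G2row; last by rewrite eq_sym ifc.
  by rewrite mxE G0' // (G0' c) // !mul0r mulr0 subr0 mul0r.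
have [G [f [ZG Gf]]] := elimination _ (leqnn n).
have finj : injective f.
  move=> x y; wlog xy : x y / (x < y)%N => [wl|].
    case: (ltngtP x y) => [xy|yx|/val_inj //]; first exact: wl.
    by move/esym/(wl _ _ yx).
  have [_ G0] := Gf _ (ltn_ord x); have [G1 _] := Gf _ (ltn_ord y) => e.
  by have /eqP := G0 _ xy; rewrite G1 e eqxx oner_eq0.
exists (perm finj); apply: borel_orbit_sym; suff <- : G = permutation_matrix F (perm finj) by [].
by apply/matrixP => i j; rewrite permutation_matrixE permE; have [] := Gf _ (ltn_ord j).
Qed.

(** Pivot on x at (i, j): clearing north and east removes the dots of column j and row i and creates
    -1/x at their opposite corner. Scaling two columns gives the swapped permutation. *)
Lemma reflect_at_orbit u (p : box n) (x : F) : p \in opp_rothe u -> x != 0 ->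
  borel_orbit (permutation_matrix F (reflect_at u p))
    (permutation_matrix F u + x *: delta_mx p.1 p.2).
Proof.
rewrite mem_opp_rothe; case: p => i j /= /andP[uji jui] x0;
have [k kE] : exists k, k = (u^-1)%g i by eexists.
have uk : u k = i by rewrite kE permKV.
rewrite -kE in jui.
have ijk : (j == k) = false by rewrite -val_eqE /= ltn_eqF.
have uijk : (u j == u k) = false by rewrite (inj_eq perm_inj).
set A := _ + _; pose A1 := clear_north i j A; pose A2 := clear_east i j A1.
suff : borel_orbit (permutation_matrix F (reflect_at u (i, j))) A2.
  move/borel_orbit_trans; apply; apply: borel_orbit_sym.
  exact: borel_orbit_trans (clear_north_orbit i j A) (clear_east_orbit i j A1).
have AE a b : A a b = (a == u b)%:R + x * ((a == u k) && (b == j))%:R.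
  by rewrite mxE permutation_matrixE !mxE uk.
have Aj a : A a j = (a == u j)%:R + x * (a == u k)%:R by rewrite AE eqxx andbT.
have Ak a : A (u k) a = (a == k)%:R + x * (a == j)%:R.
  by rewrite AE eqxx (inj_eq perm_inj) (eq_sym k).
rewrite -uk in A1 A2 uji *.
have A1row a b : a != u j -> A1 a b = A a b.
  move=> auj; rewrite mxE Aj (negbTE auj) add0r; case: eqP => [->|_].
    by rewrite ltnn mul0r subr0.
  by rewrite mulr0 !mul0r mulr0 subr0.
have A1uj b : A1 (u j) b = - x^-1 * (b == k)%:R.
  rewrite mxE uji !Ak !Aj AE !eqxx uijk ijk (inj_eq perm_inj) (eq_sym j b) /=.
  by rewrite !(mulr0, addr0, add0r, mulr1, mul1r); field.
have A1j a : A1 a j = x * (a == u k)%:R.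
  have [->|auj] := eqVneq a (u j); first by rewrite A1uj ijk uijk !mulr0.
  by rewrite A1row // Aj (negbTE auj) add0r.
have A1uk b : A1 (u k) b = A (u k) b by rewrite A1row // eq_sym uijk.
have A2row a b : a != u k -> A2 a b = A1 a b.
  by move=> auk; rewrite mxE A1j (negbTE auk) mulr0 mul0r mulr0 subr0.
have A2uk b : A2 (u k) b = x * (b == j)%:R.
  rewrite mxE !A1j eqxx A1uk Ak mulr1; case: (ltngtP j b) => [jb|bj|/val_inj<-].
  - by rewrite -!val_eqE /= (gtn_eqF jb) mulr0 addr0 mul1r mulrCA divff // mulr1 subrr.
  - rewrite -!val_eqE /= (ltn_eqF bj) mulr0 addr0 mul0r subr0 ltn_eqF //.
    exact: ltn_trans bj jui.
  - by rewrite eqxx ijk add0r mul0r subr0.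
pose d b := if b == j then x else if b == k then - x^-1 else 1.
have d0 b : d b != 0.
  rewrite /d; case: ifP => // _; case: ifP => _; last exact: oner_neq0.
  by rewrite oppr_eq0 invr_eq0.
have -> : A2 = \matrix_(a, b) (permutation_matrix F (reflect_at u (u k, j)) a b * d b).
  apply/matrixP => a b; rewrite [RHS]mxE permutation_matrixE reflect_atE /= permK /d.
  have [->|auk] := eqVneq a (u k).
    rewrite A2uk; case: (eqVneq b j) => [_|bj]; first by rewrite eqxx mulr1 mul1r.
    case: (eqVneq b k) => [_|bk]; first by rewrite eq_sym uijk mulr0 mul0r.
    by rewrite (inj_eq perm_inj) eq_sym (negbTE bk) mulr0 mul0r.
  rewrite A2row //; have [->|auj] := eqVneq a (u j).
    rewrite A1uj; case: (eqVneq b j) => [->|bj] /=; first by rewrite ijk uijk mulr0 mul0r.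
    case: (eqVneq b k) => [_|bk]; first by rewrite eqxx mulr1 mul1r.
    by rewrite (inj_eq perm_inj) eq_sym (negbTE bj) mulr0 mul0r.
  rewrite A1row // AE (negbTE auk) mulr0 addr0.
  case: (eqVneq b j) => [->|bj]; first by rewrite (negbTE auj) (negbTE auk) mul0r.
  case: (eqVneq b k) => [->|bk]; first by rewrite (negbTE auk) (negbTE auj) mul0r.
  by rewrite mulr1.
exact: scale_columns_orbit.
Qed.

End Elimination.

(** * Rational curves and the retraction onto the slice *)

Section RationalFunctions.
Variable F : numFieldType.
Implicit Types (f g : F -> F) (D P : {poly F}) (S : F -> Prop).

Lemma poly_nonroot P : P != 0 -> exists s, P.[s] != 0.
Proof.
move=> P0; have [/allP h|/allPn[s _ Ps]] :=
  boolP (all (root P) [seq (k%:R : F) | k <- iota 0 (size P)]); last by exists s.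
have := max_poly_roots P0 (introT allP h).
rewrite size_map size_iota ltnn map_inj_uniq ?iota_uniq => [/(_ isT) //|].
exact: mulrIn (oner_neq0 _).
Qed.

(** [E] holds on a Zariski open subset of the line that contains [S]; for [generic] the open set is
    merely nonempty. *)
Definition near S (E : F -> Prop) :=
  exists D, (forall s, S s -> D.[s] != 0) /\ forall s, D.[s] != 0 -> E s.

Definition generic (E : F -> Prop) :=
  exists D, D != 0 /\ forall s, D.[s] != 0 -> E s.

Lemma nearT S (E : F -> Prop) : (forall s, E s) -> near S E.
Proof. by move=> h; exists 1; split=> s *; rewrite ?hornerC ?oner_eq0. Qed.

Lemma nearI S E1 E2 : near S E1 -> near S E2 -> near S (fun s => E1 s /\ E2 s).
Proof.
move=> [D1 [h1 e1]] [D2 [h2 e2]]; exists (D1 * D2); split=> s.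
  by move=> Ss; rewrite hornerM mulf_neq0 ?h1 ?h2.
by rewrite hornerM mulf_eq0 negb_or => /andP[/e1 ? /e2 ?].
Qed.

Lemma near_mono S (E1 E2 : F -> Prop) : (forall s, E1 s -> E2 s) -> near S E1 -> near S E2.
Proof. by move=> h [D [h1 e1]]; exists D; split=> // s /e1/h. Qed.

Lemma near_forall S (I : finType) (E : I -> F -> Prop) :
  (forall i, near S (E i)) -> near S (fun s => forall i, E i s).
Proof.
move=> nE; suff: forall r : seq I, near S (fun s => forall i, i \in r -> E i s).
  by move=> /(_ (enum I)); apply: near_mono => s h i; apply: h; rewrite mem_enum.
elim=> [|i r IH]; first exact: nearT.
apply: near_mono (nearI (nE i) IH) => s [Ei Er] j.
by rewrite inE => /predU1P[->|/Er].
Qed.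

Lemma genericI E1 E2 : generic E1 -> generic E2 -> generic (fun s => E1 s /\ E2 s).
Proof.
move=> [D1 [h1 e1]] [D2 [h2 e2]]; exists (D1 * D2); split; first exact: mulf_neq0.
by move=> s; rewrite hornerM mulf_eq0 negb_or => /andP[/e1 ? /e2 ?].
Qed.

Lemma generic_mono (E1 E2 : F -> Prop) : (forall s, E1 s -> E2 s) -> generic E1 -> generic E2.
Proof. by move=> h [D [h1 e1]]; exists D; split=> // s /e1/h. Qed.

Lemma generic_ex E : generic E -> exists s, E s.
Proof. by move=> [D [/poly_nonroot[s Ds] h]]; exists s; apply: h. Qed.

Lemma near_generic S E s0 : S s0 -> near S E -> generic E.
Proof.
move=> S0 [D [D0 DE]]; exists D; split=> //.
by apply: contraTneq (D0 _ S0) => ->; rewrite horner0 eqxx.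
Qed.

(** A rational function without poles on [S]; where the denominator vanishes its value is
    arbitrary. *)
Definition regular S f := exists P D,
  (forall s, S s -> D.[s] != 0) /\ forall s, D.[s] != 0 -> f s = P.[s] / D.[s].

Lemma regular_poly S P : regular S (fun s => P.[s]).
Proof.
by exists P, 1; split=> s *; rewrite hornerC ?oner_eq0 // divr1.
Qed.

Lemma regular_cst S c : regular S (fun=> c).
Proof.
by exists c%:P, 1; split=> s *; rewrite !hornerC ?oner_eq0 // divr1.
Qed.

Lemma regularD S f g : regular S f -> regular S g -> regular S (fun s => f s + g s).
Proof.
move=> [P [D [D0 fE]]] [P' [D' [D0' gE]]].
exists (P * D' + P' * D), (D * D'); split=> s.
  by move=> Ss; rewrite hornerM mulf_neq0 ?D0 ?D0'.
rewrite !hornerE mulf_eq0 negb_or => /andP[Ds Ds'].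
by rewrite fE // gE // addf_div.
Qed.

Lemma regularM S f g : regular S f -> regular S g -> regular S (fun s => f s * g s).
Proof.
move=> [P [D [D0 fE]]] [P' [D' [D0' gE]]].
exists (P * P'), (D * D'); split=> s.
  by move=> Ss; rewrite hornerM mulf_neq0 ?D0 ?D0'.
rewrite !hornerE mulf_eq0 negb_or => /andP[Ds Ds'].
by rewrite fE // gE // mulf_div.
Qed.

Lemma regular_ext S f g : f =1 g -> regular S f -> regular S g.
Proof. by move=> fg [P [D [D0 fE]]]; exists P, D; split=> // s /fE <-. Qed.

Lemma regularB S f g : regular S f -> regular S g -> regular S (fun s => f s - g s).
Proof.
move=> rf rg; apply: (regular_ext (f := fun s => f s + -1 * g s)).
  by move=> s; rewrite mulN1r.
by apply: regularD => //; apply: regularM => //; apply: regular_cst.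
Qed.

Lemma regular_sum S (I : Type) (r : seq I) (h : I -> F -> F) :
  (forall i, regular S (h i)) -> regular S (fun s => \sum_(i <- r) h i s).
Proof.
move=> rh; elim: r => [|i r IH].
  by apply: regular_ext (regular_cst S 0) => s; rewrite big_nil.
by apply: regular_ext (regularD (rh i) IH) => s; rewrite big_cons.
Qed.

Lemma regular_prod S (I : Type) (r : seq I) (h : I -> F -> F) :
  (forall i, regular S (h i)) -> regular S (fun s => \prod_(i <- r) h i s).
Proof.
move=> rh; elim: r => [|i r IH].
  by apply: regular_ext (regular_cst S 1) => s; rewrite big_nil.
by apply: regular_ext (regularM (rh i) IH) => s; rewrite big_cons.
Qed.

Lemma regularX S f k : regular S f -> regular S (fun s => f s ^+ k).
Proof.
move=> rf; elim: k => [|k IH]; first exact: regular_cst.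
by apply: regular_ext (regularM rf IH) => s; rewrite exprS.
Qed.

Lemma regular_neq0 S f : regular S f -> (forall s, S s -> f s != 0) ->
  near S (fun s => f s != 0).
Proof.
move=> [P [D [D0 fE]]] f0; exists (P * D); split=> s.
  move=> Ss; rewrite hornerM mulf_neq0 ?D0 //.
  by apply: contraNneq (f0 _ Ss) => P0; rewrite fE ?D0 // P0 mul0r.
rewrite hornerM mulf_eq0 negb_or => /andP[Ps Ds].
by rewrite fE // mulf_neq0 // invr_eq0.
Qed.

Lemma regularV S f : regular S f -> (forall s, S s -> f s != 0) ->
  regular S (fun s => (f s)^-1).
Proof.
move=> [P [D [D0 fE]]] f0; exists (D ^+ 2), (P * D); split=> s.
  move=> Ss; rewrite hornerM mulf_neq0 ?D0 //.
  by apply: contraNneq (f0 _ Ss) => P0; rewrite fE ?D0 // P0 mul0r.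
rewrite !hornerE mulf_eq0 negb_or => /andP[Ps Ds].
by rewrite fE // invfM invrK; field; rewrite Ps Ds.
Qed.

Lemma regular_generic_neq0 S f s0 : S s0 -> regular S f -> f s0 != 0 ->
  generic (fun s => f s != 0).
Proof.
move=> S0 [P [D [D0 fE]]] fs0; exists (P * D); split.
  apply: contraNneq fs0 => PD; have := congr1 (horner^~ s0) PD.
  rewrite hornerM horner0 => /eqP; rewrite mulf_eq0 (negbTE (D0 _ S0)) orbF => /eqP P0.
  by rewrite fE ?D0 // P0 mul0r.
move=> s; rewrite hornerM mulf_eq0 negb_or => /andP[Ps Ds].
by rewrite fE // mulf_neq0 // invr_eq0.
Qed.

(** Takes the place of a limit: an identity that holds generically extends to the points of [S]. *)
Lemma regular_generic_eq0 S f s0 : S s0 -> regular S f ->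
  generic (fun s => f s = 0) -> f s0 = 0.
Proof.
move=> S0 rf f0; apply/eqP/negPn/negP => /(regular_generic_neq0 S0 rf) f1.
by have [s [-> /eqP]] := generic_ex (genericI f0 f1).
Qed.

Lemma regular_meval S m (h : 'I_m -> F -> F) (p : {mpoly F[m]}) :
  (forall i, regular S (h i)) -> regular S (fun s => p.@[fun i => h i s]).
Proof.
move=> rh; apply: (@regular_ext _ (fun s => \sum_(e <- msupp p) p@_e * \prod_i h i s ^+ e i)).
  by move=> s; rewrite mevalE.
apply: regular_sum => e; apply: regularM; first exact: regular_cst.
by apply: regular_prod => i; apply: regularX.
Qed.

Definition regular_mx S n (G : F -> 'M[F]_n) := forall i j, regular S (fun s => G s i j).

Lemma regular_mx_cst S n (Z : 'M[F]_n) : regular_mx S (fun=> Z).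
Proof. by move=> i j; apply: regular_cst. Qed.

Lemma regular_mxM S n (G H : F -> 'M[F]_n) :
  regular_mx S G -> regular_mx S H -> regular_mx S (fun s => G s *m H s).
Proof.
move=> rG rH i j; apply: (@regular_ext _ (fun s => \sum_k G s i k * H s k j)).
  by move=> s; rewrite mxE.
by apply: regular_sum => k; apply: regularM.
Qed.

Lemma regular_line S n (A B : 'M[F]_n) : regular_mx S (fun s => A + s *: B).
Proof.
move=> i j; apply: (@regular_ext _ (fun s => (A i j)%:P.[s] + 'X.[s] * (B i j)%:P.[s])).
  by move=> s; rewrite !mxE !hornerE.
by apply: regularD; last apply: regularM; apply: regular_poly.
Qed.

End RationalFunctions.

Section Chart.
Variables (C : numFieldType) (n : nat) (v : 'S_n).

Definition slice (Z : 'M[C]_n) : Prop :=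
  (forall j, Z (v j) j = 1) /\
  (forall i j : 'I_n, (i < v j)%N || ((v^-1)%g i < j)%N -> Z i j = 0).

Variables (S : C -> Prop) (G : C -> 'M[C]_n).
Hypotheses (regG : regular_mx S G) (GS : forall s, S s -> slice (G s)).

(** The invariant of the elimination: on [S] the curve is already in the slice, and each step is the
    identity there. *)
Let same_orbit (H : C -> 'M[C]_n) :=
  [/\ regular_mx S H, forall s, S s -> H s = G s & forall s, borel_orbit (G s) (H s)].

Let pivot_neq0 H j : same_orbit H -> forall s, S s -> H s (v j) j != 0.
Proof.
by case=> _ HG _ s Ss; rewrite HG //; have [-> _] := GS Ss; rewrite oner_eq0.
Qed.

Let east_zeros (H : C -> 'M[C]_n) (k : nat) (s : C) := forall c : 'I_n, (c < k)%N ->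
  forall j : 'I_n, (c < j)%N -> H s (v c) j = 0 :> C.

Let north_zeros (H : C -> 'M[C]_n) (k : nat) (s : C) := forall c : 'I_n, (k <= c)%N ->
  forall i : 'I_n, (i < v c)%N -> H s i c = 0 :> C.

Let east_cleared k : (k <= n)%N ->
  exists H : C -> 'M[C]_n, same_orbit H /\ near S (east_zeros H k).
Proof.
elim: k => [_|k IH kn].
  exists G; split; last by apply: nearT.
  by split=> // s; apply: borel_orbit_refl.
have [H [orbH zH]] := IH (ltnW kn); have [rH HG GH] := orbH; pose c := Ordinal kn.
have pivot := pivot_neq0 c orbH.
exists (fun s => clear_east (v c) c (H s)); split.
  split=> [i j|s Ss|s]; last exact: borel_orbit_trans (GH s) (clear_east_orbit _ _ _).
    apply: (@regular_ext _ _ (fun s => H s i j -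
      (c < j)%N%:R * (H s i c * (H s (v c) j * (H s (v c) c)^-1)))).
      by move=> s; rewrite mxE.
    apply: regularB => //; apply: regularM; first exact: regular_cst.
    by do 2 apply: regularM => //; apply: regularV.
  rewrite -(HG _ Ss); apply/matrixP => i j; rewrite mxE.
  have [cj|_] := boolP (c < j)%N; last by rewrite mul0r subr0.
  rewrite [H s (v c) j](_ : _ = 0) ?mul0r ?mulr0 ?subr0 // HG //.
  by have [_ ->] := GS Ss; rewrite // permK cj orbT.
apply: near_mono (nearI zH (regular_neq0 (rH _ _) pivot)) => s [z ps] c'.
rewrite ltnS leq_eqVlt => /orP[/eqP c'k|c'k] j c'j; rewrite mxE.
  have -> : c' = c by apply: val_inj.
  have cj : (c < j)%N by rewrite /= -c'k.
  by rewrite cj mul1r mulrCA divff // mulr1 subrr.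
by rewrite z // (z c') // mul0r mulr0 subr0.
Qed.

(** Columns are treated from right to left. Row v c already vanishes east of c, so clearing column c
    does not disturb the columns after it. *)
Let north_cleared k : (k <= n)%N ->
  exists H : C -> 'M[C]_n, same_orbit H /\
    near S (fun s => east_zeros H n s /\ north_zeros H (n - k) s).
Proof.
elim: k => [_|k IH kn].
  have [H [orbH zH]] := east_cleared (leqnn n); exists H; split=> //.
  by apply: near_mono zH => s z; split=> // c; rewrite subn0 leqNgt ltn_ord.
have [H [orbH zH]] := IH (ltnW kn); have [rH HG GH] := orbH.
have cn : (n - k.+1 < n)%N by lia.
pose c := Ordinal cn; have pivot := pivot_neq0 c orbH.
exists (fun s => clear_north (v c) c (H s)); split.
  split=> [i j|s Ss|s]; last exact: borel_orbit_trans (GH s) (clear_north_orbit _ _ _).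
    apply: (@regular_ext _ _ (fun s => H s i j -
      (i < v c)%N%:R * (H s i c * (H s (v c) c)^-1 * H s (v c) j))).
      by move=> s; rewrite mxE.
    apply: regularB => //; apply: regularM; first exact: regular_cst.
    by apply: regularM => //; apply: regularM => //; apply: regularV.
  rewrite -(HG _ Ss); apply/matrixP => i j; rewrite mxE.
  have [iv|_] := boolP (i < v c)%N; last by rewrite mul0r subr0.
  rewrite [H s i c](_ : _ = 0) ?mul0r ?mulr0 ?subr0 // HG //.
  by have [_ ->] := GS Ss; rewrite // iv.
apply: near_mono (nearI zH (regular_neq0 (rH _ _) pivot)) => s [[ze zn] ps].
split=> c' c'k.
  move=> j c'j; rewrite mxE (ze c' (ltn_ord c') j c'j).
  have [vc'|_] := boolP (v c' < v c)%N; last by rewrite mul0r subr0.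
  have [jc|cj] := leqP j c; last by rewrite (ze c (ltn_ord c) j cj) !mulr0 subr0.
  by rewrite (ze c' (ltn_ord c') c (leq_trans c'j jc)) !mul0r mulr0 subr0.
move=> i ivc'; rewrite mxE; have [cc'|c'c] := ltnP c c'.
  rewrite (ze c (ltn_ord c) c' cc') mulr0 mulr0 subr0 zn //.
  by move: cc' => /=; lia.
have -> : c' = c by apply/val_inj/eqP; rewrite eqn_leq c'c.
have ivc : (i < v c)%N by rewrite (_ : c = c') //; apply/val_inj/eqP; rewrite eqn_leq c'c andbT.
by rewrite ivc mul1r divfK // subrr.
Qed.

(* Triangular elimination retracts a neighbourhood of the slice onto it. *)
Lemma slice_retraction : exists Z : C -> 'M[C]_n,
  [/\ regular_mx S Z, forall s, S s -> Z s = G s &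
      near S (fun s => slice (Z s) /\ borel_orbit (G s) (Z s))].
Proof.
have [H [orbH zH]] := north_cleared (leqnn n); have [rH HG GH] := orbH.
have pivot j := pivot_neq0 j orbH.
exists (fun s => \matrix_(i, j) (H s i j * (H s (v j) j)^-1)); split.
- move=> i j; apply: (@regular_ext _ _ (fun s => H s i j * (H s (v j) j)^-1)).
    by move=> s; rewrite mxE.
  by apply: regularM => //; apply: regularV => //; apply: pivot.
- move=> s Ss; rewrite -(HG _ Ss); apply/matrixP => i j; rewrite mxE HG //.
  by have [-> _] := GS Ss; rewrite divr1.
have pivots : near S (fun s => forall j, H s (v j) j != 0).
  by apply: near_forall => j; apply: regular_neq0 => //; apply: pivot.
apply: near_mono (nearI zH pivots) => s [[ze zn] ps]; split.
  split=> [j|i j]; rewrite mxE; first by rewrite divff.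
  case/orP => [ivj|vij]; first by rewrite zn ?subnn // mul0r.
  by rewrite -(permKV v i) ze ?mul0r ?ltn_ord.
apply: borel_orbit_trans (GH s) _; apply: scale_columns_orbit => j.
by rewrite invr_eq0.
Qed.

End Chart.

(** * Algebraic independence *)

Section AlgebraicDependence.
Variable F : fieldType.

Lemma msize_mul_le d (p q : {mpoly F[d]}) a b :
  (msize p <= a.+1)%N -> (msize q <= b.+1)%N -> (msize (p * q) <= (a + b).+1)%N.
Proof.
have [->|p0] := eqVneq p 0; first by rewrite mul0r msize0.
have [->|q0] := eqVneq q 0; first by rewrite mulr0 msize0.
by rewrite msizeM //; move: (msize p) (msize q) => x y; lia.
Qed.

Lemma msize_exp_le d (p : {mpoly F[d]}) a k :
  (msize p <= a.+1)%N -> (msize (p ^+ k) <= (k * a).+1)%N.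
Proof.
move=> pa; elim: k => [|k IH]; first by rewrite expr0 msize1.
by rewrite exprS mulSn msize_mul_le.
Qed.

Lemma msize_prod_le d m (p : 'I_m -> {mpoly F[d]}) a :
  (forall i, msize (p i) <= a.+1)%N -> (msize (\prod_i p i) <= (m * a).+1)%N.
Proof.
elim: m p => [|m IH] p pa; first by rewrite big_ord0 msize1.
by rewrite big_ord_recl mulSn msize_mul_le ?IH.
Qed.

Definition mnm_of_ffun m N (e : {ffun 'I_m -> 'I_N}) : 'X_{1..m} :=
  [multinom (e i : nat) | i < m].

Lemma mnm_of_ffun_inj m N : injective (@mnm_of_ffun m N).
Proof.
move=> e e' /mnmP h; apply/ffunP => i; apply: val_inj.
by have := h i; rewrite !mnmE.
Qed.

(* There are more monomials of large bounded degree in m variables than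
   coefficients in their values at m polynomials in d < m variables. *)
Lemma algebraic_dependence d m (f : 'I_m -> {mpoly F[d]}) : (d < m)%N ->
  exists2 Q : {mpoly F[m]}, Q != 0 & Q \mPo [tuple f i | i < m] = 0.
Proof.
move=> dm; pose a := (\max_i msize (f i))%N.
(* Exponents of monomials run below N, and the values then have size at most L. As L <= N(ma+1), we
   get L^d <= N^d (ma+1)^d < N^(d+1) <= N^m. *)
pose N := ((m * a).+1 ^ d).+1; pose L := (m * (N * a)).+1.
pose I := {ffun 'I_m -> 'I_N}; pose J := {ffun 'I_d -> 'I_L}.
pose M (e : I) : {mpoly F[d]} := \prod_i f i ^+ e i.
have MsizeL e : (msize (M e) <= L)%N.
  apply: msize_prod_le => i; apply: leq_trans (msize_exp_le (a := a) _ _) _.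
    by apply: leqW; apply: leq_bigmax.
  by rewrite ltnS leq_mul2r (ltnW (ltn_ord _)) orbT.
pose A : 'M[F]_(#|I|, #|J|) := \matrix_(k, l) (M (enum_val k))@_(mnm_of_ffun (enum_val l)).
have IJ : (#|J| < #|I|)%N.
  rewrite !card_ffun !card_ord.
  have LN : (L <= N * (m * a).+1)%N by rewrite /L; nia.
  have LdN : (L ^ d <= (N * (m * a).+1) ^ d)%N by case: (d) => // k; rewrite leq_exp2r.
  apply: leq_ltn_trans LdN _; apply: (@leq_trans (N ^ d.+1)); last by rewrite leq_pexp2l.
  by rewrite expnMn expnSr ltn_pmul2l ?expn_gt0.
have : kermx A != 0.
  rewrite kermx_eq0 /row_free neq_ltn; apply/orP; left.
  exact: leq_ltn_trans (rank_leq_col A) IJ.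
case/rowV0Pn => u /sub_kermxP uA u0.
pose c (e : I) := u 0 (enum_rank e).
exists (\sum_(e : I) c e *: 'X_[mnm_of_ffun e]).
  apply: contraNneq u0 => Q0; apply/eqP/rowP => k; rewrite mxE.
  have := congr1 (mcoeff (mnm_of_ffun (enum_val k))) Q0.
  rewrite raddf_sum /= mcoeff0 (bigD1 (enum_val k)) //= big1 => [|e ek].
    by rewrite mcoeffZ mcoeffX eqxx mulr1 addr0 /c enum_valK.
  by rewrite mcoeffZ mcoeffX (inj_eq (@mnm_of_ffun_inj _ _)) (negbTE ek) mulr0.
rewrite raddf_sum /=.
rewrite (eq_bigr (fun e => c e *: M e)) => [|e _]; last first.
  rewrite comp_mpolyZ comp_mpolyX; congr (_ *: _).
  by apply: eq_bigr => i _; rewrite tnth_mktuple mnmE.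
apply/mpolyP => x; rewrite mcoeff0 raddf_sum /=.
have [xL|Lx] := ltnP (mdeg x) L; last first.
  apply: big1 => e _; rewrite mcoeffZ; apply/eqP; rewrite mulf_eq0.
  by rewrite [(M e)@_x == 0]mcoeff_eq0 msize_mdeg_ge ?orbT // (leq_trans (MsizeL e)).
have xi i : (x i < L)%N.
  by apply: leq_ltn_trans xL; rewrite mdegE (bigD1 i) //= leq_addr.
pose e' : J := [ffun i => Ordinal (xi i)].
have xE : x = mnm_of_ffun e' by apply/mnmP => i; rewrite mnmE ffunE.
have uAe : (u *m A) 0 (enum_rank e') = 0 by rewrite uA mxE.
rewrite -[RHS]uAe mxE (reindex (@enum_val I predT)) /=; last first.
  by exists enum_rank => e _; rewrite ?enum_valK ?enum_rankK.
by apply: eq_bigr => k _; rewrite mcoeffZ /c enum_valK !mxE enum_rankK xE.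
Qed.

End AlgebraicDependence.

Section LastVariable.
Variables (F : fieldType) (d : nat).

Lemma lift_max_widen (i : 'I_d) : lift ord_max i = widen_ord (leqnSn d) i.
Proof. by apply: val_inj; rewrite /= /bump leqNgt ltn_ord. Qed.

Lemma muni_coef (Q : {mpoly F[d.+1]}) (m : 'X_{1..d.+1}) :
  ((muni Q)`_(m ord_max))@_[multinom m (widen_ord (leqnSn d) i) | i < d] = Q@_m.
Proof.
rewrite muniE coef_sum raddf_sum /=.
rewrite (eq_bigr (fun e => if e == m then Q@_e else 0)) => [|e _]; last first.
  rewrite coefZ coefXn -scalerAl mcoeffZ.
  case: (eqVneq e m) => [->|em]; first by rewrite eqxx mulr1 mcoeffX eqxx mulr1.
  case: eqP => [mx|_]; last by rewrite mulr0 mcoeff0 mulr0.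
  rewrite mulr1 mcoeffX; case: eqP => [/mnmP h|_]; last by rewrite mulr0.
  case/eqP: em; apply/mnmP => i; case: (unliftP ord_max i) => [j ->|-> //].
  by have := h j; rewrite !mnmE -lift_max_widen.
have [mQ|mQ] := boolP (m \in msupp Q).
  by rewrite (bigD1_seq m) ?msupp_uniq //= eqxx big1 ?addr0 // => e /negbTE ->.
rewrite big_seq big1 => [|e eQ]; first by apply/esym/eqP; rewrite mcoeff_eq0.
by case: eqP => // em; rewrite -em eQ in mQ.
Qed.

Lemma muni_eq0 (Q : {mpoly F[d.+1]}) : muni Q = 0 -> Q = 0.
Proof. by move=> Q0; apply/mpolyP => m; rewrite -muni_coef Q0 coef0 !mcoeff0. Qed.

End LastVariable.

Section Independence.
Variables (F : fieldType) (k : nat) (T : Type) (x : T -> 'I_k -> F).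
Implicit Types (X Y : T -> Prop).

(** For matrices with their entries as coordinates this is [alg_independent_on]. *)
Definition independent_on X d (f : 'I_d -> {mpoly F[k]}) :=
  forall Q : {mpoly F[d]}, (forall t, X t -> Q.@[fun i => (f i).@[x t]] = 0) -> Q = 0.

Definition vanishes X (p : {mpoly F[k]}) := forall t, X t -> p.@[x t] = 0.

Definition snoc d (f : 'I_d -> {mpoly F[k]}) g (i : 'I_d.+1) :=
  oapp f g (unlift ord_max i).

Lemma meval_snoc d (f : 'I_d -> {mpoly F[k]}) g (Q : {mpoly F[d.+1]}) t :
  Q.@[fun i => (snoc f g i).@[x t]] =
  (map_poly (comp_mpoly [tuple f i | i < d]) (muni Q)).[g].@[x t].
Proof.
rewrite muniE raddf_sum /= horner_sum raddf_sum /= mevalE; apply: eq_bigr => m _.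
rewrite -mul_polyC rmorphM /= map_polyC /= map_polyXn hornerM hornerC hornerXn.
rewrite mevalM comp_mpolyZ mevalZ comp_mpoly_meval mevalX rmorphXn big_ord_recr /=.
rewrite -mulrA; congr (_ * (_ * _)); last by rewrite /snoc unlift_none.
apply: eq_bigr => i _.
by rewrite tnth_mktuple mnmE -lift_max_widen /snoc liftK.
Qed.

(* A relation among f and g restricts on X to a relation among f alone,
   since g vanishes there; divide it by its last variable. *)
Lemma independent_snoc X Y d (f : 'I_d -> {mpoly F[k]}) g :
  independent_on X f -> vanishes X g ->
  (forall p, vanishes Y p -> vanishes X p) ->
  (forall p, vanishes Y (g * p) -> vanishes Y p) ->
  independent_on Y (snoc f g).
Proof.
move=> indf g0 XY gY Q Q0; apply: muni_eq0.
have {Q0} : vanishes Y (map_poly (comp_mpoly [tuple f i | i < d]) (muni Q)).[g].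
  by move=> t /Q0; rewrite meval_snoc.
elim/poly_ind: (muni Q) => [//|P c IH].
rewrite rmorphD rmorphM /= map_polyX map_polyC /= !hornerE => h.
have c0 : c = 0.
  apply: indf => t Xt; have := XY _ h t Xt.
  rewrite mevalD mevalM g0 // mulr0 add0r comp_mpoly_meval => <-.
  by apply: meval_eq => i; rewrite tnth_mktuple.
have P0 : P = 0.
  apply: IH; apply: gY => t Yt.
  by have := h t Yt; rewrite c0 rmorph0 addr0 mulrC.
by rewrite P0 c0 mul0r add0r.
Qed.

End Independence.

(** * Dimension of the strata *)

Section Strata.
Variables (C : numFieldType) (n : nat) (v : 'S_n).
Implicit Types (Z : 'M[C]_n) (u w : 'S_n) (f g h : {mpoly C[n * n]}).

Definition entries Z (e : 'I_(n * n)) : C := mxvec Z 0 e.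

Definition stratum u Z := slice v Z /\ borel_orbit (permutation_matrix C u) Z.

Lemma regular_entries S (Z : C -> 'M[C]_n) f : regular_mx S Z ->
  regular S (fun s => f.@[entries (Z s)]).
Proof.
move=> rZ; apply: (regular_meval (h := fun e s => entries (Z s) e)) => e.
case/mxvec_indexP: e => i j; apply: regular_ext (rZ i j) => s.
by rewrite /entries mxvecE.
Qed.

Lemma borel_line (A B : 'M[C]_n) : borel A -> borel B ->
  generic (fun s => borel (A + s *: (B - A))).
Proof.
move=> bA bB; have [[A0 _] [B0 _]] := (bA, bB).
pose S (s : C) := s = 0.
have : near S (fun s => forall i, (A + s *: (B - A)) i i != 0).
  apply: near_forall => i; apply: regular_neq0 => [|s ->].
    exact: (@regular_line _ _ _ A (B - A)).
  by rewrite scale0r addr0 borel_diag.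
move/(near_generic (erefl : S 0)); apply: generic_mono => s diag.
by apply: upper_borel => // i j ji; rewrite !mxE A0 // B0 // subr0 mulr0 addr0.
Qed.

(** Turns a curve in the double coset, easily written down, into one in the stratum through the same
    points over [S]. *)
Lemma stratum_curve S s0 u (G : C -> 'M[C]_n) :
  S s0 -> regular_mx S G -> (forall s, S s -> slice v (G s)) ->
  generic (fun s => borel_orbit (permutation_matrix C u) (G s)) ->
  exists W, [/\ regular_mx S W, forall s, S s -> W s = G s &
                generic (fun s => stratum u (W s))].
Proof.
move=> S0 rG GS oG; have [W [rW WG Wnear]] := slice_retraction rG GS.
exists W; split=> //; apply: generic_mono (genericI oG (near_generic S0 Wnear)).
by move=> s [uG [vW GW]]; split=> //; apply: borel_orbit_trans uG GW.
Qed.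

(** Write Z as a u c with a, c triangular and perturb u by s at the box p: for nonzero s the result
    lies in the coset of [reflect_at u p]. Retract onto the slice and let s go to 0. *)
Lemma vanishes_closure u p f : p \in opp_rothe u ->
  vanishes entries (stratum (reflect_at u p)) f -> vanishes entries (stratum u) f.
Proof.
move=> pu f0 Z [vZ [a [c [ba bc ZE]]]]; pose S (s : C) := s = 0.
have [W [rW W0 uW]] : exists W, [/\ regular_mx S W, W 0 = Z &
    generic (fun s => stratum (reflect_at u p) (W s))].
  pose G s := a *m (permutation_matrix C u + s *: delta_mx p.1 p.2) *m c.
  have G0 : G 0 = Z by rewrite /G scale0r addr0.
  have [|s ->||W [rW WG uW]] := @stratum_curve S 0 (reflect_at u p) G erefl.
  - apply: regular_mxM; last exact: regular_mx_cst.
    by apply: regular_mxM; [apply: regular_mx_cst | apply: regular_line].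
  - by rewrite G0.
  - exists 'X; split=> [|s]; rewrite ?polyX_eq0 // hornerX => sn0.
    apply: borel_orbit_trans (reflect_at_orbit pu sn0) _.
    by exists a, c.
  - by exists W; split=> //; rewrite WG.
have := regular_generic_eq0 (erefl : S 0) (regular_entries f rW).
by rewrite W0; apply; apply: generic_mono uW => s /f0.
Qed.

(** Irreducibility: if h did not vanish at Z2, then on a curve of the stratum joining Z1 to Z2
    neither g nor h would vanish generically. *)
Lemma stratum_nonzerodivisor u Z1 g h : stratum u Z1 -> g.@[entries Z1] != 0 ->
  vanishes entries (stratum u) (g * h) -> vanishes entries (stratum u) h.
Proof.
move=> [vZ1 [a1 [c1 [ba1 bc1 Z1E]]]] gZ1 gh Z2 [vZ2 [a2 [c2 [ba2 bc2 Z2E]]]].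
apply/eqP/negPn/negP => hZ2; pose S (s : C) := s = 0 \/ s = 1.
have S0 : S 0 by left.
have S1 : S 1 by right.
have [W [rW [W0 W1] uW]] : exists W, [/\ regular_mx S W, W 0 = Z1 /\ W 1 = Z2 &
    generic (fun s => stratum u (W s))].
  pose a s := a1 + s *: (a2 - a1); pose c s := c1 + s *: (c2 - c1).
  pose G s := a s *m permutation_matrix C u *m c s.
  have G1 : G 0 = Z1 by rewrite /G /a /c !scale0r !addr0.
  have G2 : G 1 = Z2 by rewrite /G /a /c !scale1r !subrKC.
  have [|s [->|->]||W [rW WG uW]] := @stratum_curve S 0 u G S0.
  - apply: regular_mxM; last exact: regular_line.
    by apply: regular_mxM; [apply: regular_line | apply: regular_mx_cst].
  - by rewrite G1.
  - by rewrite G2.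
  - have := genericI (borel_line ba1 ba2) (borel_line bc1 bc2).
    by apply: generic_mono => s [bas bcs]; exists (a s), (c s).
  - by exists W; split=> //; rewrite !WG.
have gW : generic (fun s => g.@[entries (W s)] != 0).
  by apply: (regular_generic_neq0 S0 (regular_entries g rW)); rewrite W0.
have hW : generic (fun s => h.@[entries (W s)] != 0).
  by apply: (regular_generic_neq0 S1 (regular_entries h rW)); rewrite W1.
have [s [[gs hs] /gh/eqP]] := generic_ex (genericI (genericI gW hW) uW).
by rewrite mevalM mulf_eq0 (negbTE gs) (negbTE hs).
Qed.

Lemma minor_neq0 p q (A : 'M[C]_(p, q)) :
  exists (f : 'I_(\rank A) -> 'I_p) (g : 'I_(\rank A) -> 'I_q),
  \det (mxsub f g A) != 0.
Proof.
pose B := (rowsub (maxrankfun A) A)^T.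
have Bfull : row_full B.
  by rewrite /row_full mxrank_tr; apply: maxrowsub_free.
exists (maxrankfun A), (fullrankfun Bfull).
have := fullrowsub_unit Bfull; rewrite unitmxE unitfE -det_tr.
by rewrite -trmx_mxsub trmxK -mxsub_comp.
Qed.

Lemma minor_eq0 p q r (A : 'M[C]_(p, q)) (f : 'I_r -> 'I_p) (g : 'I_r -> 'I_q) :
  (\rank A < r)%N -> \det (mxsub f g A) = 0.
Proof.
move=> Ar; apply/eqP/negPn; rewrite -unitfE -unitmxE -row_free_unit.
apply: contraL Ar; rewrite -leqNgt => /eqP <-.
have -> : mxsub f g A = rowsub f 1%:M *m A *m colsub g 1%:M.
  by rewrite mulmx_colsub mulmx1 mul_rowsub_mx mul1mx -mxsub_comp.
exact: leq_trans (mxrankM_maxl _ _) (mxrankM_maxr _ _).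
Qed.

Definition generic_matrix : 'M[{mpoly C[n * n]}]_n := \matrix_(i, j) 'X_(mxvec_index i j).

Lemma meval_minor r (f g : 'I_r -> 'I_n) Z :
  (\det (mxsub f g generic_matrix)).@[entries Z] = \det (mxsub f g Z).
Proof.
rewrite -det_map_mx /=; congr (\det _); apply/matrixP => i j.
by rewrite !mxE mevalXU /entries mxvecE.
Qed.

(** A minor of maximal size in the corner, nonzero at Z1, exceeds the corner rank on the stratum of
    u. *)
Lemma stratum_separated u u' (a b : 'I_n) Z1 : (dot_count u a b < dot_count u' a b)%N ->
  stratum u' Z1 -> exists2 g, vanishes entries (stratum u) g & g.@[entries Z1] != 0.
Proof.
move=> uu' [_ oZ1].
have r1 := corner_rank_orbit a b oZ1; rewrite corner_rank_perm in r1.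
rewrite /corner_rank in r1; move: r1; set A := mxsub _ _ _ => r1.
have [f [g fg]] := minor_neq0 A.
exists (\det (mxsub (fun k => enum_val (f k)) (fun l => enum_val (g l)) generic_matrix)).
  move=> Z [_ oZ]; rewrite meval_minor mxsub_comp; apply: minor_eq0.
  rewrite r1; apply: leq_ltn_trans uu'.
  by have := corner_rank_orbit a b oZ; rewrite corner_rank_perm => <-.
by rewrite meval_minor mxsub_comp.
Qed.

Lemma stratum_nonempty u d (f : 'I_d -> {mpoly C[n * n]}) :
  independent_on entries (stratum u) f -> exists Z, stratum u Z.
Proof.
move=> indf; apply: contrapT => e.
have /eqP := indf 1 (fun t ut => False_ind _ (e (ex_intro _ t ut))).
by rewrite oner_eq0.
Qed.

Lemma independent_step u p d (f : 'I_d -> {mpoly C[n * n]}) : p \in opp_rothe u ->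
  independent_on entries (stratum u) f ->
  exists f' : 'I_d.+1 -> {mpoly C[n * n]},
    independent_on entries (stratum (reflect_at u p)) f'.
Proof.
move=> pu indf.
have [Z1 uZ1] : exists Z, stratum (reflect_at u p) Z.
  (* Were the larger stratum empty, 1 would vanish on it, hence on the smaller one. *)
  apply: contrapT => e; have [Z uZ] := stratum_nonempty indf.
  have := vanishes_closure pu (f := 1) (fun t ut => False_ind _ (e (ex_intro _ t ut))) uZ.
  by move/eqP; rewrite meval1 oner_eq0.
have [a [b ab]] := dots_lt_reflect pu.
have [g g0 gZ1] := stratum_separated ab uZ1.
exists (snoc f g); apply: independent_snoc indf g0 _ _.
  by move=> q; apply: vanishes_closure.
by move=> q; apply: stratum_nonzerodivisor uZ1 gZ1.
Qed.

Lemma slice_permutation : slice v (permutation_matrix C v).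
Proof.
split=> [j|i j]; rewrite permutation_matrixE ?eqxx //.
case: eqP => // ->; by rewrite permK !ltnn.
Qed.

Lemma independent_stratum w : dots_le v w ->
  exists f : 'I_(#|opp_rothe v| - #|opp_rothe w|) -> {mpoly C[n * n]},
    independent_on entries (stratum w) f.
Proof.
move=> vw.
have ind0 : exists f : 'I_0 -> {mpoly C[n * n]}, independent_on entries (stratum v) f.
  exists (fun=> 0) => Q /(_ (permutation_matrix C v)) => h.
  (* Without variables Q is constant; evaluation at the point v shows that it is zero. *)
  have Qc : Q = (Q@_0)%:MP.
    apply/mpolyP => m; rewrite mcoeffC.
    have -> : m = 0%MM by apply/mnmP => -[].
    by rewrite eqxx mulr1.
  rewrite Qc mevalC in h *; rewrite h //; split; first exact: slice_permutation.
  exact: borel_orbit_refl.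
suff gen u : dots_le u w -> forall d (f : 'I_d -> {mpoly C[n * n]}),
    independent_on entries (stratum u) f ->
    exists f' : 'I_(d + (#|opp_rothe u| - #|opp_rothe w|)) -> {mpoly C[n * n]},
    independent_on entries (stratum w) f'.
  by have [f indf] := ind0; apply: (gen _ vw _ _ indf).
move: u; apply: dots_le_ind => [u p pu pmid le IH d f indf|d f indf]; last first.
  by rewrite subnn addn0; exists f.
have [f' indf'] := independent_step pu indf.
have := IH _ _ indf'.
by rewrite (noninversions_reflect pu pmid) subSn ?dots_le_card // addSnnS.
Qed.

(** The entries on the slice are polynomials in the free coordinates, one for each box; more
    functions than that are dependent. *)
Lemma slice_dim d (f : 'I_d -> {mpoly C[n * n]}) :
  independent_on entries (slice v) f -> (d <= #|opp_rothe v|)%N.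
Proof.
move=> indf; rewrite leqNgt; apply/negP => dm.
pose coord (p : box n) : {mpoly C[#|opp_rothe v|]} :=
  ((p.1 == v p.2)%:R)%:MP + \sum_(k | enum_val k == p) 'X_k.
pose param := [tuple mxvec (\matrix_(i, j) coord (i, j)) 0 e | e < n * n].
have [Q Q0 Qf] := algebraic_dependence (fun i => f i \mPo param) dm.
case/eqP: Q0; apply: indf => Z vZ.
pose y (k : 'I_#|opp_rothe v|) := Z (enum_val k).1 (enum_val k).2.
have entriesE e : entries Z e = (tnth param e).@[y].
  rewrite tnth_mktuple; case/mxvec_indexP: e => i j; rewrite /entries !mxvecE mxE.
  rewrite mevalD mevalC raddf_sum /=.
  have [pv|npv] := boolP ((i, j) \in opp_rothe v).
    rewrite (big_pred1 (enum_rank_in pv (i, j))) => [|k].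
      rewrite mevalXU /y enum_rankK_in //=; move: pv; rewrite mem_opp_rothe /=.
      by case: eqP => [->|_ _]; rewrite ?ltnn // add0r.
    by rewrite /= -(inj_eq enum_val_inj) enum_rankK_in.
  rewrite big_pred0 => [|k]; last first.
    by apply: contraNF npv => /eqP <-; apply: enum_valP.
  have [Z1 Z0] := vZ; rewrite addr0; case: eqP => [->|/eqP ivj]; first exact: Z1.
  apply: Z0; move: npv; rewrite mem_opp_rothe /= negb_and -!leqNgt leq_eqVlt.
  rewrite (inj_eq val_inj) (negbTE ivj) /= => /orP[->//|]; rewrite leq_eqVlt.
  by case/predU1P => [/val_inj e|->]; [rewrite -e permKV eqxx in ivj | rewrite orbT].
transitivity ((Q \mPo [tuple f i \mPo param | i < d]).@[y]); last by rewrite Qf meval0.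
rewrite comp_mpoly_meval; apply: meval_eq => i; rewrite tnth_mktuple comp_mpoly_meval.
by apply: meval_eq => e; apply: entriesE.
Qed.

(** Each cover adds a function and removes a box, so the sum is constant on the way up; with no box
    left, [slice_dim] applies. *)
Lemma stratum_dim u d (f : 'I_d -> {mpoly C[n * n]}) :
  independent_on entries (stratum u) f -> (d + #|opp_rothe u| <= #|opp_rothe v|)%N.
Proof.
have [m mE] : exists m, m = #|opp_rothe u| by eexists.
elim: m u d f mE => [|m IH] u d f mE indf; rewrite -mE.
  rewrite addn0; apply: (slice_dim (f := f)) => Q h; apply: indf => Z [vZ _].
  exact: h.
have /cover_exists[p pu pmid] : (0 < #|opp_rothe u|)%N by rewrite -mE.
have [f' indf'] := independent_step pu indf.
have := noninversions_reflect pu pmid; rewrite -mE => -[me].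
by have := IH _ _ f' me indf'; rewrite -me addSnnS.
Qed.

(** Permuting the rows by v makes Z lower unitriangular. *)
Lemma slice_unit Z : slice v Z -> Z \in unitmx.
Proof.
move=> [Z1 Z0]; have := row_permE v Z => /(congr1 (fun M => \det M)).
rewrite det_mulmx [LHS]det_trig; last first.
  by apply/is_trig_mxP => i j ij; rewrite mxE Z0 // permK ij orbT.
rewrite big1 => [|i _]; last by rewrite mxE.
rewrite unitmxE unitfE => /esym/eqP; apply: contraTneq => ->.
by rewrite mulr0 eq_sym oner_eq0.
Qed.

Definition slice_below w Z := slice v Z /\
  forall a b, (corner_rank Z a b <= corner_rank (permutation_matrix C w) a b)%N.

Lemma slice_belowP w Z : slice_below w Z <-> exists2 u, dots_le u w & stratum u Z.
Proof.
split=> [[vZ rZ]|[u uw [vZ oZ]]]; last first.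
  split=> // a b; rewrite (corner_rank_orbit a b oZ).
  exact: (proj2 (corner_rank_dots_le C u w) uw).
have [u oZ] := bruhat_decomposition (slice_unit vZ); exists u => //.
apply/(corner_rank_dots_le C u w) => a b.
by rewrite -(corner_rank_orbit a b oZ).
Qed.

Lemma slice_below_dim_ge w : dots_le v w ->
  exists f : 'I_(#|opp_rothe v| - #|opp_rothe w|) -> {mpoly C[n * n]},
    independent_on entries (slice_below w) f.
Proof.
move=> /independent_stratum[f indf]; exists f => Q Q0; apply: indf => Z wZ.
by apply: Q0; apply/slice_belowP; exists w.
Qed.

(** If f is dependent on every stratum below w, the product of the relations is a nonzero relation
    on their union. So f is independent on one of them. *)
Lemma slice_below_dim_le w d (f : 'I_d -> {mpoly C[n * n]}) :
  independent_on entries (slice_below w) f -> (d <= #|opp_rothe v| - #|opp_rothe w|)%N.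
Proof.
move=> indf.
have [[u uw /stratum_dim le]|none] :=
    EM (exists2 u, dots_le u w & independent_on entries (stratum u) f).
  by have := dots_le_card uw; lia.
have relation u : exists Qu : {mpoly C[d]}, Qu != 0 /\
    (dots_le u w -> forall Z, stratum u Z -> Qu.@[fun i => (f i).@[entries Z]] = 0).
  (* The relation 1 stands in for the permutations that are not below w. *)
  have [uw|nuw] := EM (dots_le u w); last by exists 1; split=> //; apply: oner_neq0.
  apply: contrapT => h; apply: none; exists u => // Qu Q0; apply: contrapT => /eqP nQ.
  by apply: h; exists Qu.
have [Q QP] := fin_all_exists relation.
have prodQ Z : slice_below w Z -> (\prod_u Q u).@[fun i => (f i).@[entries Z]] = 0.
  move=> /slice_belowP[u uw uZ]; rewrite (bigD1 u) //= mevalM.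
  by have [_ ->] := QP u; rewrite // mul0r.
have : \prod_u Q u != 0 by apply/prodf_neq0 => u _; have [] := QP u.
by rewrite (indf _ prodQ) eqxx.
Qed.

End Strata.

(** * Torus limits and the weight cone *)

Section TorusLimit.
Variables (C : numFieldType) (n : nat) (v : 'S_n).
Implicit Types (Z : 'M[C]_n) (w : 'S_n) (p : box n).

Lemma corner_rank_semicontinuous S s0 (W : C -> 'M[C]_n) a b :
  S s0 -> regular_mx S W ->
  generic (fun s => (corner_rank (W s0) a b <= corner_rank (W s) a b)%N).
Proof.
move=> S0 rW; rewrite {1}/corner_rank; set A := mxsub _ _ _.
have [f [g fg]] := minor_neq0 A.
pose q := \det (mxsub (fun k => enum_val (f k)) (fun l => enum_val (g l)) (generic_matrix C n)).
have := regular_generic_neq0 S0 (regular_entries q rW).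
rewrite meval_minor mxsub_comp => /(_ fg).
apply: generic_mono => s; rewrite meval_minor leqNgt mxsub_comp.
by apply: contraNN => /(minor_eq0 f g) ->.
Qed.

(** An edge from x to y carries the weight e_x - e_y of a nonzero coordinate, and weights add up
    along paths. *)
Definition support_edge Z : rel 'I_n := fun x y =>
  ((y, (v^-1)%g x) \in opp_rothe v) && (Z y ((v^-1)%g x) != 0).

Definition other_edge Z p : rel 'I_n := fun x y =>
  support_edge Z x y && ((x, y) != (v p.2, p.1)).

(* The one-parameter subgroup t^mu, with mu increasing along all the edges of
   the support of Z except p, moves Z to its p-part as t goes to 0. *)
Lemma unreachable_reflect w Z p : slice_below v w Z -> p \in opp_rothe v ->
  Z p.1 p.2 != 0 -> ~~ connect (other_edge Z p) (v p.2) p.1 ->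
  bruhat (reflect_at v p) w.
Proof.
move=> [[Z1 Z0] rZ] pv Zp npath; apply: dots_le_bruhat.
have pv' := pv; rewrite mem_opp_rothe in pv'; case/andP: pv' => vp pj.
(* The shift applies to the vertices reachable without p: it makes the ends of p level, and every
   other edge stays increasing because reachability passes along it. *)
pose mu (x : 'I_n) := (x + (p.1 - v p.2) * connect (other_edge Z p) (v p.2) x)%N.
have mu_p : mu p.1 = mu (v p.2).
  by rewrite /mu (negbTE npath) connect0 muln0 muln1 addn0 subnKC // ltnW.
have mu_other i j : Z i j != 0 -> i != v j -> (i, j) != p -> (mu (v j) < mu i)%N.
  move=> Zij iv ijp.
  have ij : (i, j) \in opp_rothe v.
    apply: contraNT Zij; rewrite mem_opp_rothe /= negb_and -!leqNgt => h.
    rewrite Z0 //; case/orP: h => [|ji].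
      by rewrite leq_eqVlt (inj_eq val_inj) (negbTE iv) /= => ->.
    rewrite orbC ltn_neqAle ji andbT (_ : _ != _) //.
    by apply: contraNneq iv => /val_inj <-; rewrite permKV.
  have e : other_edge Z p (v j) i.
    rewrite /other_edge /support_edge permK ij Zij /=.
    apply: contraNneq ijp => -[/perm_inj -> ->]; by rewrite -surjective_pairing.
  have vji : (v j < i)%N by move: ij; rewrite mem_opp_rothe => /andP[].
  rewrite /mu -addSn leq_add // leq_mul2l; apply/orP; right.
  case: (boolP (connect _ _ (v j))) => // c.
  by rewrite (connect_trans c (connect1 e)).
(* The truncated exponent is harmless, since mu does not decrease along the support. At t = 0 only
   the dots and p keep exponent 0. *)
pose W (t : C) : 'M[C]_n := \matrix_(i, j) (Z i j * t ^+ (mu i - mu (v j))).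
have rW : regular_mx (fun t => t = 0) W.
  move=> i j; apply: (@regular_ext _ _ (fun t => (Z i j)%:P.[t] * ('X ^+ (mu i - mu (v j))).[t])).
    by move=> t; rewrite mxE !hornerE.
  by apply: regularM; apply: regular_poly.
have W0 : W 0 = permutation_matrix C v + Z p.1 p.2 *: delta_mx p.1 p.2.
  apply/matrixP => i j; rewrite mxE [RHS]mxE permutation_matrixE !mxE.
  have [->|iv] := eqVneq i (v j).
    rewrite Z1 mul1r subnn expr0 (_ : _ && _ = false) ?mulr0 ?addr0 //.
    by apply/negP => /andP[/eqP e /eqP ej]; move: vp; rewrite -e ej ltnn.
  rewrite add0r; have [ip|nip] := eqVneq (i, j) p.
    have [-> ->] : i = p.1 /\ j = p.2 by rewrite -ip.
    by rewrite !eqxx mu_p subnn expr0.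
  rewrite (_ : _ && _ = false) ?mulr0; last first.
    by apply: contraNF nip => /andP[/eqP -> /eqP ->]; rewrite -surjective_pairing.
  have [->|Zij] := eqVneq (Z i j) 0; first by rewrite mul0r.
  by rewrite expr0n subn_eq0 leqNgt (mu_other _ _ Zij) // mulr0.
have WZ t : t != 0 -> borel_orbit Z (W t).
  move=> t0; exists (diag_mx (\row_i t ^+ mu i)), (diag_mx (\row_j t ^- mu (v j))).
  have diag_borel (d : 'rV[C]_n) : (forall i, d 0 i != 0) -> borel (diag_mx d).
    move=> d0; apply: upper_borel => [i j ji|i]; rewrite mxE ?eqxx ?mulr1n //.
    by rewrite -val_eqE /= gtn_eqF.
  split; try by apply: diag_borel => i; rewrite mxE ?invr_eq0 expf_neq0.
  rewrite mul_mx_diag mul_diag_mx; apply/matrixP => i j; rewrite !mxE.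
  have [->|iv] := eqVneq i (v j); first by rewrite Z1 subnn !mulr1 divff ?expf_neq0.
  have [->|Zij] := eqVneq (Z i j) 0; first by rewrite mulr0 !mul0r.
  have mule : (mu (v j) <= mu i)%N.
    have [ip|nip] := eqVneq (i, j) p; last by rewrite ltnW ?mu_other.
    by move: mu_p; rewrite -ip /= => ->.
  by rewrite expfB_cond ?(negbTE t0) //= mulrA [Z i j * _]mulrC.
apply/(corner_rank_dots_le C _ w) => a b.
rewrite -(corner_rank_orbit a b (reflect_at_orbit pv Zp)) -W0.
have t0 : generic (fun t : C => t != 0).
  by exists 'X; split=> [|s]; rewrite ?polyX_eq0 // hornerX.
have [t [tn0 le]] := generic_ex (genericI t0
  (corner_rank_semicontinuous a b (erefl : (fun t : C => t = 0) 0) rW)).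
by apply: leq_trans le _; rewrite (corner_rank_orbit a b (WZ _ tn0)).
Qed.

(** Induction on p.1 - v p.2. Either p.1 is unreachable and the weight is a generator, or a path of
    other support edges writes it as a sum of shorter weights. *)
Lemma support_weight_cone (R : realType) w Z p : slice_below v w Z -> p \in opp_rothe v ->
  Z p.1 p.2 != 0 -> weight_cone v w (box_vector R v p).
Proof.
move=> wZ; have [m] := ubnP (p.1 - v p.2)%N.
elim: m p => // m IH p; rewrite ltnS => pm pv Zp.
have [|/(unreachable_reflect wZ pv Zp) pw] :=
    boolP (connect (other_edge Z p) (v p.2) p.1); last first.
  by apply: cone_generated_gen; rewrite inE pv.
case/connectP => s sP sE.
suff step (s' : seq 'I_n) : path (other_edge Z p) (v p.2) s' -> (last (v p.2) s' <= p.1)%N ->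
    (v p.2 <= last (v p.2) s')%N /\
    weight_cone v w (coord_vector R (v p.2) - coord_vector R (last (v p.2) s')).
  by have [|_] := step s sP; rewrite -sE.
elim/last_ind: s' => [|s' y IHs] /=.
  by rewrite subrr => _ _; split=> //; apply: cone_generated0.
rewrite rcons_path last_rcons => /andP[/IHs{}IHs]; set x := last _ s' in IHs *.
case/andP=> /andP[qv Zq] xy yp; have qv' := qv; rewrite mem_opp_rothe /= permKV in qv'.
case/andP: qv' => lxy _; have [vx cx] := IHs (ltnW (leq_trans lxy yp)).
split; first exact: leq_trans vx (ltnW lxy).
have -> : coord_vector R (v p.2) - coord_vector R y =
  (coord_vector R (v p.2) - coord_vector R x) + box_vector R v (y, (v^-1)%g x).
  by rewrite /box_vector /= permKV addrA subrK.
apply: cone_generatedD => //; apply: IH => //=; rewrite permKV.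
(* The edge runs between v p.2 and p.1 and is not p, so it is strictly shorter. *)
apply: leq_trans pm; move: xy; rewrite xpair_eqE negb_and -!(inj_eq val_inj) /=.
lia.
Qed.

End TorusLimit.

(** * The two dimensions combined *)

Section Complexity.
Variables (R : realType) (n : nat) (v w : 'S_n).

Lemma variety_dim_KL : dots_le v w ->
  variety_dim (KL_variety (R := R) v w) = (#|opp_rothe v| - #|opp_rothe w|)%N.
Proof.
move=> vw; rewrite /variety_dim.
pose P d := `[< exists f : 'I_d -> {mpoly R[i][n * n]},
                 alg_independent_on (KL_variety v w) f >].
apply: (@bigmax_bool_eq (n * n) P).
- rewrite ltnS (leq_trans (leq_subr _ _)) // (leq_trans (max_card _)) //.
  by rewrite card_prod card_ord.
- by apply/asboolP; have [f indf] := slice_below_dim_ge R[i] vw; exists f.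
- by move=> d _ /asboolP[f indf]; apply: (@slice_below_dim_le R[i] _ _ _ _ f).
Qed.

Lemma box_vector_weight_cone :
  (forall p, ~~ unexpected_zero v w p) \/ (forall p, ~ actual_zero R v w p) ->
  forall q, q \in opp_rothe v -> weight_cone v w (box_vector R v q).
Proof.
case=> [noz|noz] q qv.
  apply: cone_generated_gen; rewrite inE qv.
  by have := noz q; rewrite /unexpected_zero qv negbK.
have [Z wZ Zq] : exists2 Z, slice_below (C := R[i]) v w Z & Z q.1 q.2 != 0.
  apply: contrapT => h; apply: (noz q); split=> // Z wZ.
  by apply/eqP/negPn/negP => Zq; apply: h; exists Z.
exact: support_weight_cone wZ qv Zq.
Qed.

End Complexity.

Theorem corollary4p9 (R : realType) (n : nat) (v w : 'S_n)
    (hvw : bruhat v w)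
    (hzeros : (forall p : box n, ~~ unexpected_zero v w p) \/
              (forall p : box n, ~ actual_zero R v w p)) :
  complexity R v w = #|rothe_pairs v|%:Z - #|opp_rothe w|%:Z /\
  (toric R v w <-> #|rothe_pairs v| = #|opp_rothe w|).
Proof.
have vw := bruhat_dots hvw.
have cE : complexity R v w = #|rothe_pairs v|%:Z - #|opp_rothe w|%:Z.
  rewrite /complexity variety_dim_KL // (weight_cone_dim (box_vector_weight_cone hzeros)).
  (* The bound on the diagrams makes the truncated subtraction in the dimension a true one. *)
  have := dots_le_card vw; have := card_cut_boxes v; lia.
by split=> //; rewrite /toric cE; split; lia.
Qed.
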